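(* Let $\varepsilon>0$. Assume $c_\varepsilon(x,0)$, $x\in\mathbb{R}$, is a non-negative function of compact support with $c_\varepsilon(x,0)=0$ for $x<0$ and $0<\int_0^\infty(1+x)c_\varepsilon(x,0)\,dx<\infty$. Let $c_\varepsilon(x,t)$, $x\in\mathbb{R}$, $t>0$, be the solution with initial data $c_\varepsilon(\cdot,0)$ of the whole-line problem $$\frac{\partial c_\varepsilon}{\partial t}=\frac{\partial}{\partial x}\left\{\left[1-\frac{x}{\Lambda_\varepsilon(t)}\right]c_\varepsilon\right\}+\frac{\varepsilon}{2}\frac{\partial^2 c_\varepsilon}{\partial x^2},\quad x\in\mathbb{R},\ t>0,\qquad \Lambda_\varepsilon(t)=\frac{\int_0^\infty x\,c_\varepsilon(x,t)\,dx}{\int_0^\infty c_\varepsilon(x,t)\,dx}.$$ Then $\displaystyle\lim_{t\to\infty}\frac{d\Lambda_\varepsilon(t)}{dt}=1$.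
   Context: The problem is non-linear because the parameter function $\Lambda_\varepsilon(\cdot)$ in the PDE is determined by the solution itself through the stated ratio of integrals over the positive half line. *)

(* Defs.v *)
From mathcomp Require Import all_boot all_order all_algebra.
From mathcomp Require Import all_classical all_reals all_analysis.

Set Implicit Arguments.
Unset Strict Implicit.
Unset Printing Implicit Defensive.

Import Order.TTheory GRing.Theory Num.Theory.
Import numFieldNormedType.Exports.

Local Open Scope classical_set_scope.
Local Open Scope ring_scope.

Section whole_line_problem.
Context {R : realType}.
Local Notation mu := (@lebesgue_measure R).
Implicit Types (c : R -> R -> R) (eps x t : R).

(* Throughout, c is applied as [c x t] (space, then time). *)

Definition Lambda c t : R :=
  (\int[mu]_(x in `[0%R, +oo[) (x * c x t)) /
  (\int[mu]_(x in `[0%R, +oo[) c x t).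

Definition dt c x t : R := (fun s => c x s)^`()%classic t.
Definition dx c x t : R := (fun y => c y t)^`()%classic x.

(* [derive1] is total: the derivatives are required to exist separately. *)
Definition C21 c : Prop :=
  forall x t, 0 < t ->
    [/\ derivable (fun s => c x s) t 1,
        derivable (fun y => c y t) x 1 &
        derivable (fun y => dx c y t) x 1] /\
    [/\ {for (x, t), continuous (fun p : R * R => dt c p.1 p.2)},
        {for (x, t), continuous (fun p : R * R => dx c p.1 p.2)} &
        {for (x, t), continuous (fun p : R * R => dx (dx c) p.1 p.2)}].

(* t |-> c(., t) is a continuous map from [0, +oo[ to L^1(R, (1 + |x|) dx);
   at t = 0 this is the sense in which the initial data are attained. *)
Definition continuous_weightedL1 c : Prop :=
  (forall t, 0 <= t ->
     mu.-integrable [set: R] (fun x => ((1 + `|x|) * c x t)%:E)) /\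
  (forall t0, 0 <= t0 ->
     (fun t => \int[mu]_x ((1 + `|x|) * `|c x t - c x t0|)%:E)%E
       @ within `[0, +oo[ (nbhs t0) --> 0%E).

(* Classical solution of the whole-line problem with initial data c(., 0).
   Division by 0 is total in the library: the second clause says that the
   denominators occurring in the equation do not vanish. *)
Definition whole_line_solution eps c : Prop :=
  [/\ continuous_weightedL1 c,
      forall t, 0 <= t ->
        \int[mu]_(x in `[0%R, +oo[) c x t != 0 /\ Lambda c t != 0,
      C21 c &
      forall x t, 0 < t ->
        dt c x t = dx (fun y s => (1 - y / Lambda c s) * c y s) x t
                   + eps / 2 * dx (dx c) x t].

End whole_line_problem.

(* Main.v *)
Require Import Defs.
From mathcomp Require Import all_boot all_order all_algebra.
From mathcomp Require Import all_classical all_reals all_analysis.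
From mathcomp Require Import measurable_realfun.
From mathcomp Require Import ring lra.

(* The nonlinearity is removed by the characteristics of the drift: let
   m' = m / Lambda, tau' = 1 / m, v' = eps / m^2 with m(0) = 1 and
   tau(0) = v(0) = 0.  If psi solves the heat equation psi_w = psi_zz / 2, then
   phi(x, t) = psi(x / m(t) + tau(t) - tau(T), v(T) - v(t)) solves the backward
   equation adjoint to the Fokker-Planck equation, so that the integral of
   c phi is constant in time.  Taking for psi the solutions issued from the
   indicator of the half line and from the positive part expresses Lambda(T) as
   m N1 / N0, where N0 and N1 are the mass and the mean on the half line of the
   initial datum, translated by -tau and convolved with a Gaussian of variance v.
   Hence Lambda = m lambda(tau, v) with m' = 1 / lambda, and Lambda' is an
   explicit expression in Gaussian integrals.  As t tends to infinity, tau and m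
   tend to infinity, v stays bounded and tau / m tends to 0, and Mills ratio
   inequalities (from the positivity of the iterated primitives of the Gaussian)
   squeeze Lambda' to 1. *)

Set Implicit Arguments.
Unset Strict Implicit.
Unset Printing Implicit Defensive.

Import Order.TTheory GRing.Theory Num.Theory.
Import numFieldNormedType.Exports.

Local Open Scope classical_set_scope.
Local Open Scope ring_scope.

(** * Calculus of one real variable *)

Section calculus.
Context {R : realType}.
Implicit Types (f g : R -> R) (a b x : R).

(** The obstacle is that [c] is controlled only in [L^1((1 + |x|) dx)]: no decay of its derivatives
    is assumed, so the adjoint computation must be run with compactly supported test functions, and
    the error terms have to vanish although both the drift and the test function grow linearly.
    Moreover, the equation holds only for positive times and the backward solution is singular at
    [T], so conservation is proved strictly inside [(0, T)] and pushed to both endpoints by limits.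
    The long-time analysis is a bootstrap. If [tau] were bounded, [m' = N0 / N1] would be bounded,
    [m] at most linear, and [tau' = 1 / m] would force logarithmic growth of [tau]. Once [tau] is
    large, a Mills bound and [v <= eps tau] give [m' >= 1 / (2 eps)], whence [v] is bounded and
    [tau = O(ln m)]. The dominant term of [Lambda'] is [(N1 / N0) (Ng / N0)], where [Ng] is the
    density at the origin of the translated, smoothed datum; in the far tail the two factors behave
    like [v / tau] and [tau / v], so the product tends to 1 whatever [v] does between its bounds. *)

Lemma is_derive_ceq f x a b : a = b -> is_derive x 1 f a -> is_derive x 1 f b.
Proof. by move=> <-. Qed.

Lemma is_derive_fadd f g x a b : is_derive x 1 f a -> is_derive x 1 g b ->
  is_derive x 1 (fun y => f y + g y) (a + b).
Proof. by move=> fa gb; exact: is_deriveD. Qed.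

Lemma is_derive_fopp f x a : is_derive x 1 f a ->
  is_derive x 1 (fun y => - f y) (- a).
Proof. by move=> fa; exact: is_deriveN. Qed.

Lemma is_derive_fsub f g x a b : is_derive x 1 f a -> is_derive x 1 g b ->
  is_derive x 1 (fun y => f y - g y) (a - b).
Proof. by move=> fa gb; exact: is_deriveB. Qed.

Lemma is_derive_fmul f g x a b : is_derive x 1 f a -> is_derive x 1 g b ->
  is_derive x 1 (fun y => f y * g y) (a * g x + f x * b).
Proof.
move=> fa gb; apply: (is_derive_ceq _ (is_deriveM fa gb)).
rewrite /GRing.scale/=; ring.
Qed.

Lemma is_derive_fconst k x : is_derive x 1 (fun=> k : R) 0.
Proof. exact: is_derive_cst. Qed.

Lemma is_derive_fid x : is_derive x 1 (fun y : R => y) 1.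
Proof. exact: is_derive_id. Qed.

Lemma is_derive_finv f x a : f x != 0 -> is_derive x 1 f a ->
  is_derive x 1 (fun y => (f y)^-1) (- a / f x ^+ 2).
Proof.
move=> fx0 fa; apply: (is_derive_ceq _ (is_deriveV fx0 fa)).
by rewrite /GRing.scale/= !mulNr mulrC.
Qed.

Lemma is_derive_fcomp f g x a b : is_derive (g x) 1 f a -> is_derive x 1 g b ->
  is_derive x 1 (fun y => f (g y)) (a * b).
Proof. by move=> fa gb; exact: is_derive1_comp. Qed.

Lemma is_derive_fexpR f x a : is_derive x 1 f a ->
  is_derive x 1 (fun y => expR (f y)) (expR (f x) * a).
Proof. by move=> fa; exact: is_derive_fcomp. Qed.

Lemma is_derive_fsqrt f x a : 0 < f x -> is_derive x 1 f a ->
  is_derive x 1 (fun y => Num.sqrt (f y)) (a / (2 * Num.sqrt (f x))).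
Proof.
move=> fx0 fa; rewrite mulrC; exact: (is_derive_fcomp (is_derive1_sqrt fx0) fa).
Qed.

Lemma is_derive_fln f x a : 0 < f x -> is_derive x 1 f a ->
  is_derive x 1 (fun y => ln (f y)) (a / f x).
Proof.
move=> fx0 fa; rewrite mulrC; exact: (is_derive_fcomp (is_derive1_ln fx0) fa).
Qed.

Lemma is_derive_fsqr f x a : is_derive x 1 f a ->
  is_derive x 1 (fun y => f y ^+ 2) (2 * f x * a).
Proof.
move=> fa; apply: (is_derive_ceq _ (is_derive_fmul fa fa)); ring.
Qed.

Lemma is_derive_continuous f x a : is_derive x 1 f a -> {for x, continuous f}.
Proof.
move=> fa; apply/differentiable_continuous/derivable1_diffP.
exact: (@ex_derive _ _ _ _ _ _ _ fa).
Qed.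

Lemma derivable_is_derive f x : derivable f x 1 -> is_derive x 1 f (f^`()%classic x).
Proof. by move=> h; rewrite derive1E; apply/derivableP. Qed.

Lemma is_derive_derive1 f x a : is_derive x 1 f a -> f^`()%classic x = a.
Proof. by move=> fa; rewrite derive1E derive_val. Qed.

Lemma mean_value f df a b : a < b ->
  (forall x, a <= x <= b -> is_derive x 1 f (df x)) ->
  exists2 c, a < c < b & f b - f a = df c * (b - a).
Proof.
move=> ab fd.
have [| |c] := @MVT R f df a b ab.
- by move=> x; rewrite in_itv/= => /andP[ax xb]; apply: fd; rewrite !ltW.
- apply: continuous_in_subspaceT => x; rewrite inE/= in_itv/= => xab.
  exact/is_derive_continuous/(fd _ xab).
- by rewrite in_itv/= => cab e; exists c.
Qed.

Lemma is_derive_ge0_le f df a b : a <= b ->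
  (forall x, a <= x <= b -> is_derive x 1 f (df x)) ->
  (forall x, a < x < b -> 0 <= df x) -> f a <= f b.
Proof.
rewrite le_eqVlt => /predU1P[->//|ab fd df0].
have [c cab e] := mean_value ab fd.
by rewrite -subr_ge0 e mulr_ge0 ?df0// subr_ge0 ltW.
Qed.

Lemma is_derive_gt0_lt f df a b : a < b ->
  (forall x, a <= x <= b -> is_derive x 1 f (df x)) ->
  (forall x, a < x < b -> 0 < df x) -> f a < f b.
Proof.
move=> ab fd df0; have [c cab e] := mean_value ab fd.
by rewrite -subr_gt0 e mulr_gt0 ?df0// subr_gt0.
Qed.

Lemma continuous_antiderivative f : continuous f ->
  exists2 F : R -> R, F 0 = 0 & forall x, 0 <= x -> is_derive x 1 F (f x).
Proof.
(* The integral starts at -1 rather than 0, so that 0 is an interior point and the derivative there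
   is two-sided. *)
move=> cf; pose F0 x : R := \int[lebesgue_measure]_(t in `[-1, x]) f t.
have F0f x : 0 <= x -> is_derive x 1 F0 (f x).
  move=> x0.
  have [|||dF F'] := @continuous_FTC1 R f (BLeft (-1)) x (x + 1) _ _ _ (cf x).
  - lra.
  - apply: continuous_compact_integrable; first exact: segment_compact.
    exact: continuous_subspaceT.
  - by rewrite /Order.lt/= /lt_bound/=; lra.
  - by rewrite -F'; exact: derivable_is_derive.
exists (fun x => F0 x - F0 0) => [|x x0]; first by rewrite subrr.
by rewrite -[f x]subr0; apply: is_derive_fsub (F0f _ x0) (is_derive_fconst _ _).
Qed.

(** The engine of the Gaussian tail inequalities below: a monotone function with limit 0 at [-oo]
    cannot be negative, so an inequality between functions follows from the one between their
    derivatives. *)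
Lemma ge0_of_cvg0_ninfty f df :
  (forall x, is_derive x 1 f (df x)) -> (forall x, 0 <= df x) ->
  f x @[x --> -oo] --> 0 -> forall x, 0 <= f x.
Proof.
move=> fd df0 f0 x; apply/ler_addgt0Pr => e e0.
have /cvgrPdist_lt /(_ _ e0) := f0.
move=> -[M [_ HM]].
pose y := Num.min x (M - 1).
have yM : y < M by rewrite /y gt_min; apply/orP; right; lra.
have yx : y <= x by rewrite /y ge_min lexx.
have := HM y yM; rewrite sub0r normrN ltr_norml => /andP[fy _].
have : f y <= f x by exact: (is_derive_ge0_le yx (fun z _ => fd z)).
lra.
Qed.

Lemma cvg0_ninfty_of_le f k : (forall x, x <= -1 -> `|f x| <= k / - x) ->
  f x @[x --> -oo] --> 0.
Proof.
move=> fk; apply/cvgrPdist_lt => e e0.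
exists (Num.min (-1) (- (`|k| + 1) / e)); split; first exact: num_real.
move=> x; rewrite lt_min => /andP[x1 xk].
rewrite sub0r normrN (le_lt_trans (fk x (ltW x1)))//.
rewrite ltr_pdivrMr; last lra.
have : e * (- (`|k| + 1) / e) = - (`|k| + 1) by field; lra.
move: xk; rewrite -(ltr_pM2l e0) => + ek; rewrite ek => xk.
by have := ler_norm k; lra.
Qed.

End calculus.

(** * The Gaussian and its iterated primitives *)

Section gaussian.
Context {R : realType}.
Implicit Types a b x : R.

Definition gauss a : R := expR (- (a ^+ 2 / 2)).

Lemma gauss_gt0 a : 0 < gauss a. Proof. exact: expR_gt0. Qed.

Lemma gaussN a : gauss (- a) = gauss a.
Proof. by rewrite /gauss sqrrN. Qed.

Lemma gauss_le1 a : gauss a <= 1.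
Proof. by rewrite expR_le1; have := sqr_ge0 a; lra. Qed.

Lemma norm_mul_gauss_le1 a : `|a| * gauss a <= 1.
Proof.
rewrite /gauss expRN ler_pdivrMr ?expR_gt0// mul1r.
have := expR_ge1Dx (a ^+ 2 / 2).
have := sqr_ge0 (`|a| - 1); rewrite -(real_normK (num_real a)); lra.
Qed.

(** Completing the square: [a ^+ 2 / 2 + a + 2 = ((a + 1) ^+ 2 + 3) / 2]. The comparison function is
    its own primitive, which is what transfers the bound to [Phi]. *)
Lemma gauss_le_expR a : gauss a <= expR (a + 2).
Proof. by rewrite ler_expR; have := sqr_ge0 (a + 1); lra. Qed.

Lemma is_derive_gauss a : is_derive a 1 gauss (- a * gauss a).
Proof.
apply: (is_derive_ceq _ (is_derive_fexpR (is_derive_fopp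
  (is_derive_fmul (is_derive_fsqr (is_derive_fid a)) (is_derive_fconst _ _))))).
by rewrite /gauss; field.
Qed.

Lemma continuous_gauss : continuous gauss.
Proof. by move=> a; exact: is_derive_continuous (is_derive_gauss a). Qed.

Lemma integrable_gauss :
  (@lebesgue_measure R).-integrable [set: R] (EFin \o gauss).
Proof.
have [k k0 gk] : exists2 k : R, 0 <= k & forall a, gauss a = k * normal_pdf 0 1 a.
  exists (normal_peak 1)^-1; first by rewrite invr_ge0 normal_peak_ge0.
  move=> a; rewrite normal_pdfE// /normal_fun mulrA mulVf ?mul1r.
    by rewrite /gauss subr0 expr1n mulNr.
  by rewrite gt_eqF// normal_peak_gt0.
have -> : EFin \o gauss = (fun a => k%:E * (normal_pdf 0 1 a)%:E)%E.
  by apply/funext => a /=; rewrite gk EFinM.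
apply: integrableZl => //; exact: integrable_normal_pdf.
Qed.

Definition gauss_int a : R := \int[lebesgue_measure]_(t in `]-oo, a]) gauss t.

Lemma is_derive_gauss_int a : is_derive a 1 gauss_int (gauss a).
Proof.
have [|||d e] := @continuous_FTC1 R gauss (BInfty _ true) a (a + 1) _ _ _
  (@continuous_gauss a).
- lra.
- exact: (integrableS measurableT _ _ integrable_gauss).
- by rewrite /Order.lt/=.
- by rewrite -e; exact: derivable_is_derive.
Qed.

(* Unnormalised: the primitive of [gauss] vanishing at [-oo]. *)
Definition Phi a : R := gauss_int a - inf (range gauss_int).

Lemma is_derive_Phi a : is_derive a 1 Phi (gauss a).
Proof.
rewrite -[gauss a]subr0.
exact: is_derive_fsub (is_derive_gauss_int a) (is_derive_fconst _ _).
Qed.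

Lemma Phi_lt a b : a < b -> Phi a < Phi b.
Proof.
move=> ab; apply: (is_derive_gt0_lt ab (fun x _ => is_derive_Phi x)) => x _.
exact: gauss_gt0.
Qed.

Lemma Phi_le a b : a <= b -> Phi a <= Phi b.
Proof. by rewrite le_eqVlt => /predU1P[->//|/Phi_lt/ltW]. Qed.

Lemma Phi_ge0 a : 0 <= Phi a.
Proof.
rewrite subr_ge0; apply: ge_inf; last by exists a.
exists 0 => _ [x _ <-]; apply: Rintegral_ge0 => t _; exact/ltW/gauss_gt0.
Qed.

Lemma Phi_gt0 a : 0 < Phi a.
Proof. by apply: le_lt_trans (Phi_ge0 (a - 1)) _; apply: Phi_lt; lra. Qed.

(** A point where [gauss_int] is within [e] of its infimum bounds [Phi] by [e] on everything to its
    left. Subtracting the infimum in [Phi] is what makes this limit immediate. *)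
Lemma cvg_Phi_ninfty : Phi a @[a --> -oo] --> 0.
Proof.
apply/cvgrPdist_lt => e e0.
have [|_ [b _ <-] be] := @inf_adherent R (range gauss_int) _ e0.
  split; first by exists (gauss_int 0), 0.
  exists 0 => _ [x _ <-]; apply: Rintegral_ge0 => t _; exact/ltW/gauss_gt0.
exists b; split; first exact: num_real.
move=> x xb; rewrite sub0r normrN ger0_norm ?Phi_ge0//.
by rewrite (lt_trans (Phi_lt xb))// /Phi ltrBlDl.
Qed.

(** The constant is [24 = 4!], from [1 + y ^+ 4 / 4! <= expR y] at [y = - x]. Power four is one more
    than the degree of the polynomial factors met below, which leaves the decay [1 / - x] asked by
    [cvg0_ninfty_of_le]. *)
Lemma expR_le_inv x : x <= -1 -> expR (x + 2) <= 24 * expR 2 / x ^+ 4.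
Proof.
move=> x1; have := @expR_ge1Dxn R (- x) 3; rewrite expRN => /(_ ltac:(lra)).
have -> : (- x) ^+ 4 = x ^+ 4 by ring.
have x4 : 0 < x ^+ 4 by rewrite exprn_even_gt0//= lt_eqF//; lra.
have -> : 4`!%:R = 24 :> R by [].
have ex := expR_gt0 x; have e2 := expR_gt0 (2 : R).
rewrite expRD ler_pdivlMr// -(ler_pM2l ex) mulfV ?gt_eqF// => h.
have : expR x * (1 + x ^+ 4 / 24) * (24 * expR 2) <= 1 * (24 * expR 2).
  by rewrite ler_wpM2r//; lra.
have -> : expR x * (1 + x ^+ 4 / 24) * (24 * expR 2) =
  24 * (expR x * expR 2) + expR x * expR 2 * x ^+ 4 by field.
by have := mulr_gt0 ex e2; lra.
Qed.

Lemma Phi_le_expR a : Phi a <= expR (a + 2).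
Proof.
rewrite -subr_ge0; move: a.
apply: (@ge0_of_cvg0_ninfty R _ (fun a => expR (a + 2) - gauss a)).
- move=> a; apply: is_derive_fsub (is_derive_Phi a).
  apply: (is_derive_ceq _ (is_derive_fexpR
    (is_derive_fadd (is_derive_fid a) (is_derive_fconst 2 a)))).
  by rewrite addr0 mulr1.
- by move=> a; rewrite subr_ge0 gauss_le_expR.
rewrite -[0]subr0; apply: cvgB cvg_Phi_ninfty.
apply: (@cvg0_ninfty_of_le _ _ (24 * expR 2)) => x x1.
rewrite ger0_norm ?expR_ge0// (le_trans (expR_le_inv x1))//.
have e2 := expR_gt0 (2 : R).
rewrite ler_pM2l; last by rewrite mulr_gt0.
rewrite lef_pV2 ?posrE; [|by rewrite exprn_even_gt0//= lt_eqF//; lra|lra].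
rewrite (_ : x ^+ 4 = (- x) ^+ 4); last by ring.
by rewrite -[leLHS]expr1 ler_weXn2l//; lra.
Qed.

(** [E1], [J], [K] are the iterated primitives of [Phi] from [-oo], in closed form through
    [n I_n = a I_(n-1) + I_(n-2)], starting with [gauss] and [Phi]. [E1 a] is also the integral of
    the positive part of [a - y] against [gauss y]. *)
Definition E1 a : R := a * Phi a + gauss a.
Let J a : R := ((1 + a ^+ 2) * Phi a + a * gauss a) / 2.
Let K a : R := (a * J a + E1 a) / 3.

Lemma is_derive_E1 a : is_derive a 1 E1 (Phi a).
Proof.
apply: (is_derive_ceq _ (is_derive_fadd
  (is_derive_fmul (is_derive_fid a) (is_derive_Phi a)) (is_derive_gauss a))).
ring.
Qed.

Let is_derive_J a : is_derive a 1 J (E1 a).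
Proof.
apply: (is_derive_ceq _ (is_derive_fmul (is_derive_fadd (is_derive_fmul
  (is_derive_fadd (is_derive_fconst 1 a) (is_derive_fsqr (is_derive_fid a)))
  (is_derive_Phi a)) (is_derive_fmul (is_derive_fid a) (is_derive_gauss a)))
  (is_derive_fconst _ a))).
by rewrite /E1; field.
Qed.

Let is_derive_K a : is_derive a 1 K (J a).
Proof.
apply: (is_derive_ceq _ (is_derive_fmul (is_derive_fadd (is_derive_fmul
  (is_derive_fid a) (is_derive_J a)) (is_derive_E1 a))
  (is_derive_fconst _ a))).
by rewrite /E1 /J; field.
Qed.

(** Factors of at most cubic growth are absorbed by the exponential tails of [Phi] and [gauss]; this
    supplies the limit at [-oo] for each of [E1], [J] and [K]. *)
Let cvg_ninfty (p q : R -> R) k : 0 <= k ->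
  (forall x, x <= -1 -> `|p x| <= k * (- x) ^+ 3) ->
  (forall x, x <= -1 -> `|q x| <= k * (- x) ^+ 3) ->
  p x * Phi x + q x * gauss x @[x --> -oo] --> 0.
Proof.
move=> k0 pk qk; apply: (@cvg0_ninfty_of_le _ _ (k * (48 * expR 2))) => x x1.
have e2 := expR_gt0 (2 : R).
have x4 : 0 < (- x) ^+ 4 by rewrite exprn_gt0//; lra.
have hk : k * (- x) ^+ 3 * expR (x + 2) <= k * (24 * expR 2) / - x.
  have -> : k * (24 * expR 2) / - x =
      k * (- x) ^+ 3 * (24 * expR 2 / x ^+ 4) by field; lra.
  rewrite ler_wpM2l ?expR_le_inv// mulr_ge0// exprn_ge0//; lra.
have -> : k * (48 * expR 2) / - x = k * (24 * expR 2) / - x + k * (24 * expR 2) / - x.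
  by field; lra.
rewrite (le_trans (ler_normD _ _))// lerD//; apply: le_trans hk; rewrite normrM.
  by rewrite ler_pM ?pk// ger0_norm ?Phi_ge0// Phi_le_expR.
by rewrite ler_pM ?qk// ger0_norm ?gauss_le_expR// ltW// gauss_gt0.
Qed.

Lemma E1_ge0 a : 0 <= E1 a.
Proof.
move: a; apply: ge0_of_cvg0_ninfty is_derive_E1 Phi_ge0 _.
rewrite (_ : (fun x => E1 x) = (fun x => x * Phi x + 1 * gauss x)); last first.
  by apply/funext => x; rewrite mul1r.
apply: (@cvg_ninfty id (fun=> 1) 1) => // x x1; rewrite mul1r.
  by rewrite ler0_norm; [rewrite -[leLHS]expr1 ler_weXn2l//; lra|lra].
by rewrite normr1 exprn_ege1//; lra.
Qed.

Let J_ge0 a : 0 <= J a.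
Proof.
move: a; apply: ge0_of_cvg0_ninfty is_derive_J E1_ge0 _.
rewrite (_ : (fun x => J x) = (fun x => (1 + x ^+ 2) / 2 * Phi x + x / 2 * gauss x)); last first.
  by apply/funext => x; rewrite /J; field.
apply: (@cvg_ninfty (fun x => (1 + x ^+ 2) / 2) (fun x => x / 2) 1) => // x x1; rewrite mul1r.
  rewrite ger0_norm; last by have := sqr_ge0 x; lra.
  have : 0 <= (- x - 1) * (x ^+ 2 ) by rewrite mulr_ge0 ?sqr_ge0//; lra.
  have : 0 <= (- x - 1) * (- x + 1) by rewrite mulr_ge0//; lra.
  by rewrite !exprSr expr0; lra.
rewrite ler0_norm; last lra.
have : - x <= (- x) ^+ 3 by rewrite -[leLHS]expr1 ler_weXn2l//; lra.
lra.
Qed.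

Let K_ge0 a : 0 <= K a.
Proof.
move: a; apply: ge0_of_cvg0_ninfty is_derive_K J_ge0 _.
rewrite (_ : (fun x => K x) = (fun x =>
    (x * (3 + x ^+ 2)) / 6 * Phi x + (2 + x ^+ 2) / 6 * gauss x)); last first.
  by apply/funext => x; rewrite /K /J /E1; field.
apply: (@cvg_ninfty (fun x => x * (3 + x ^+ 2) / 6) (fun x => (2 + x ^+ 2) / 6) 1) => // x x1; rewrite mul1r.
  have -> : x * (3 + x ^+ 2) / 6 = - ((- x) * (3 + x ^+ 2) / 6) by ring.
  have x2 := sqr_ge0 x.
  have h : - x <= (- x) ^+ 3 by rewrite -[leLHS]expr1 ler_weXn2l//; lra.
  have x3 : (- x) * x ^+ 2 = (- x) ^+ 3 by ring.
  rewrite normrN ger0_norm; first by lra.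
  by rewrite !mulr_ge0//; lra.
rewrite ger0_norm; last by have := sqr_ge0 x; lra.
have : 0 <= (- x - 1) * (x ^+ 2 ) by rewrite mulr_ge0 ?sqr_ge0//; lra.
have : 0 <= (- x - 1) * (- x + 1) by rewrite mulr_ge0//; lra.
by rewrite !exprSr expr0; lra.
Qed.

Lemma E1_gt0 a : 0 < E1 a.
Proof.
apply: le_lt_trans (E1_ge0 (a - 1)) _.
apply: (@is_derive_gt0_lt R E1 Phi (a - 1) a) => [|x _|x _]; first lra.
  exact: is_derive_E1.
exact: Phi_gt0.
Qed.

Lemma E1_le a b : a <= b -> E1 a <= E1 b.
Proof.
move=> ab; apply: (is_derive_ge0_le ab (fun x _ => is_derive_E1 x)) => x _.
exact: Phi_ge0.
Qed.

(** Read off from [2 J a = a E1 a + Phi a] at [a = - b]. The next lemma comes likewise from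
    [6 K a = (2 + a ^+ 2) E1 a + a Phi a]. Together they pin [E1 (- b) / Phi (- b)] between
    [b / (2 + b ^+ 2)] and [1 / b] for [b > 0]. *)
Lemma mul_E1N_le_Phi b : b * E1 (- b) <= Phi (- b).
Proof. by have := J_ge0 (- b); rewrite /J /E1; lra. Qed.

Lemma mul_PhiN_le_E1 b : b * Phi (- b) <= (2 + b ^+ 2) * E1 (- b).
Proof. by have := K_ge0 (- b); rewrite /K /J /E1; lra. Qed.

(** The total mass of [gauss], that is the square root of [2 pi], as twice its left half. Its value
    is never computed: it cancels in the ratio defining [Lambda]. *)
Definition kap : R := 2 * Phi 0.

Lemma kap_gt0 : 0 < kap. Proof. by rewrite mulr_gt0// Phi_gt0. Qed.

Lemma PhiN a : Phi (- a) = kap - Phi a.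
Proof.
have : (fun x => Phi x + Phi (- x)) a = (fun x => Phi x + Phi (- x)) 0.
  apply: (@is_derive_0_is_cst R (fun x => Phi x + Phi (- x))) => x.
  apply: (is_derive_ceq _ (is_derive_fadd (is_derive_Phi x) (is_derive_fcomp
    (is_derive_Phi (- x)) (is_derive_fopp (is_derive_fid x))))).
  by rewrite gaussN; ring.
by rewrite /= oppr0 /kap; lra.
Qed.

Lemma Phi_le_kap a : Phi a <= kap.
Proof. by have := Phi_ge0 (- a); rewrite PhiN; lra. Qed.

Lemma E1N a : E1 (- a) = E1 a - kap * a.
Proof. by rewrite /E1 PhiN gaussN; ring. Qed.

Lemma E1_0 : E1 0 = 1.
Proof. by rewrite /E1 /gauss expr0n/= !mul0r oppr0 expR0 add0r. Qed.

(** The reflection [E1N] reduces [a > 0] to a nonpositive argument, where [E1] lies between 0 and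
    [E1 0 = 1]. *)
Lemma E1_near_ramp a : 0 <= E1 a - kap * Num.max a 0 <= 1.
Proof.
have [a0|/ltW a0] := leP a 0.
  by rewrite mulr0 subr0 E1_ge0 -E1_0 E1_le.
by rewrite -E1N E1_ge0 -E1_0 E1_le//; lra.
Qed.

End gaussian.

(** * Weak formulation with a cutoff *)

Section integrals.
Context {R : realType}.
Local Notation mu := (@lebesgue_measure R).
Implicit Types a b r s t u v x y : R.

Lemma Rintegral_derivative (F f : R -> R) a b : a < b ->
  (forall x, is_derive x 1 F (f x)) -> continuous f ->
  \int[mu]_(x in `[a, b]) f x = F b - F a.
Proof.
move=> ab Ff cf; rewrite /Rintegral (continuous_FTC2 ab _ _ _ (F := F))//=.
- exact: continuous_subspaceT.
- split; first by move=> x _; exact: (@ex_derive _ _ _ _ _ _ _ (Ff x)).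
    by apply: cvg_at_right_filter; exact: is_derive_continuous (Ff a).
  by apply: cvg_at_left_filter; exact: is_derive_continuous (Ff b).
- by move=> x _; exact: is_derive_derive1 (Ff x).
Qed.

Lemma is_derive_Rintegral (f f' : R -> R -> R) (B : set R) (G : R -> R) a u v :
  measurable B -> u < a < v ->
  (forall t, u < t < v -> mu.-integrable B (EFin \o f t)) ->
  (forall t x, u < t < v -> B x -> is_derive t 1 (fun s => f s x) (f' t x)) ->
  (forall x, 0 <= G x) -> mu.-integrable B (EFin \o G) ->
  (forall t x, u < t < v -> B x -> `|f' t x| <= G x) ->
  is_derive a 1 (fun t => \int[mu]_(x in B) f t x) (\int[mu]_(x in B) f' a x).
Proof.
move=> mB uav fi ff' G0 Gi f'G.
have uavE t : (`]u, v[%classic t) = (u < t < v) :> Prop by rewrite /= in_itv.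
have d1 t x : u < t < v -> B x -> partial1of2 f t x = f' t x.
  by move=> tuv Bx; exact: is_derive_derive1 (ff' _ _ tuv Bx).
have cv := @cvg_differentiation_under_integral R _ _ mu f B mB a u v _ _ _ G G0 Gi.
have -> : \int[mu]_(x in B) f' a x = \int[mu]_(x in B) partial1of2 f a x.
  by apply: eq_Rintegral => x; rewrite inE => Bx; rewrite d1.
have ha : `]u, v[%classic a by rewrite uavE.
rewrite -(@differentiation_under_integral R _ _ mu f B mB a u v ha _ _ G G0 Gi).
- apply: derivable_is_derive.
  apply: (@derivable_under_integral R _ _ mu f B mB a u v ha _ _ G G0 Gi).
  + by move=> t; rewrite uavE => /fi.
  + by move=> t x; rewrite uavE => tuv Bx; exact: (@ex_derive _ _ _ _ _ _ _ (ff' t x tuv Bx)).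
  + by move=> t x; rewrite uavE => tuv Bx; rewrite d1// f'G.
- by move=> t; rewrite uavE => /fi.
- by move=> t x; rewrite uavE => tuv Bx; exact: (@ex_derive _ _ _ _ _ _ _ (ff' t x tuv Bx)).
- by move=> t x; rewrite uavE => tuv Bx; rewrite d1// f'G.
Qed.

Lemma integrable_segment (f : R -> R) a b : continuous f ->
  mu.-integrable `[a, b] (EFin \o f).
Proof.
move=> cf; apply: continuous_compact_integrable; first exact: segment_compact.
exact: continuous_subspaceT.
Qed.

Lemma ge0_Rintegral_subset (A B : set R) (f : R -> R) : measurable A ->
  measurable B -> A `<=` B -> (forall x, 0 <= f x) ->
  mu.-integrable B (EFin \o f) ->
  \int[mu]_(x in A) f x <= \int[mu]_(x in B) f x.
Proof.
move=> mA mB AB f0 fi; rewrite /Rintegral fine_le//.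
- by apply: integrable_fin_num => //; exact: integrableS fi.
- exact: integrable_fin_num.
- apply: ge0_subset_integral => //; first exact: measurable_int fi.
  by move=> x _; rewrite lee_fin.
Qed.

Lemma continuous_segment_bounded (f : R -> R) a b : continuous f ->
  exists2 M : R, 0 <= M & forall x, a <= x <= b -> `|f x| <= M.
Proof.
move=> cf.
have := @continuous_compact _ _ f `[a, b] (continuous_subspaceT cf)
  (@segment_compact R a b).
move=> /compact_bounded[M [_ Mf]].
exists (Num.max 0 (M + 1)); first by rewrite le_max lexx.
move=> x xab; apply: (Mf (Num.max 0 (M + 1))).
  by rewrite lt_max ltrDl ltr01 orbT.
by exists x => //=; rewrite in_itv.
Qed.

End integrals.

(** * Time derivative of the localised integral of [c phi] *)

Section weak_formulation.
Context {R : realType}.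
Local Notation mu := (@lebesgue_measure R).
Implicit Types a b r s t u v x y : R.
Variables (eps : R) (c : R -> R -> R) (Lam : R -> R).
Hypothesis eps_gt0 : 0 < eps.
Hypothesis cC : C21 c.
Hypothesis pde : forall x t, 0 < t ->
  dt c x t = dx (fun y s => (1 - y / Lam s) * c y s) x t
             + eps / 2 * dx (dx c) x t.

Lemma C21_dt x t : 0 < t -> is_derive t 1 (fun s => c x s) (dt c x t).
Proof. by move=> t0; have [[h _ _] _] := cC x t0; exact: derivable_is_derive. Qed.

Lemma C21_dx x t : 0 < t -> is_derive x 1 (fun y => c y t) (dx c x t).
Proof. by move=> t0; have [[_ h _] _] := cC x t0; exact: derivable_is_derive. Qed.

Lemma C21_dxx x t : 0 < t ->
  is_derive x 1 (fun y => dx c y t) (dx (dx c) x t).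
Proof. by move=> t0; have [[_ _ h] _] := cC x t0; exact: derivable_is_derive. Qed.

Lemma C21_continuous_slice t : 0 < t ->
  [/\ continuous (fun x => c x t), continuous (fun x => dt c x t),
      continuous (fun x => dx c x t) & continuous (fun x => dx (dx c) x t)].
Proof.
move=> t0.
have pr x : (fun y : R => (y, t)) y @[y --> x] --> (x, t).
  by apply: (@cvg_pair _ _ _ (nbhs x) (nbhs x) (nbhs t)); [exact: cvg_id|exact: cvg_cst].
split=> x.
- exact: is_derive_continuous (C21_dx x t0).
- have [_ [h _ _]] := cC x t0.
  exact: (cvg_comp (fun y : R => (y, t)) (fun p : R * R => dt c p.1 p.2) (pr x) h).
- exact: is_derive_continuous (C21_dxx x t0).
- have [_ [_ _ h]] := cC x t0.
  exact: (cvg_comp (fun y : R => (y, t)) (fun p : R * R => dx (dx c) p.1 p.2) (pr x) h).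
Qed.

Lemma fokker_planck x t : 0 < t ->
  dt c x t = - c x t / Lam t + (1 - x / Lam t) * dx c x t
             + eps / 2 * dx (dx c) x t.
Proof.
move=> t0; rewrite pde//; congr (_ + _).
apply: is_derive_derive1.
apply: (is_derive_ceq _ (is_derive_fmul (is_derive_fsub (is_derive_fconst 1 x)
  (is_derive_fmul (is_derive_fid x) (is_derive_fconst _ x))) (C21_dx x t0))).
by ring.
Qed.

Lemma C21_dt_bounded u v r : 0 < u ->
  exists2 M : R, 0 <= M & forall x t, - r <= x <= r -> u <= t <= v -> `|dt c x t| <= M.
Proof.
move=> u0; pose K := (`[- r, r] `*` `[u, v])%classic : set (R * R).
have cK : compact K by apply: compact_setX; exact: segment_compact.
have cf : {within K, continuous (fun p : R * R => dt c p.1 p.2)}.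
  apply: continuous_in_subspaceT => -[x t]; rewrite inE => -[_ /=].
  rewrite in_itv/= => /andP[ut _].
  by have [_ []] := cC x (lt_le_trans u0 ut).
have /compact_bounded[M [_ Mf]] := continuous_compact cf cK.
exists (Num.max 0 (M + 1)); first by rewrite le_max lexx.
move=> x t xr tuv; apply: (Mf (Num.max 0 (M + 1))).
  by rewrite lt_max ltrDl ltr01 orbT.
by exists (x, t) => //; split; rewrite /= in_itv.
Qed.

(** [C21] states joint continuity for the derivatives of [c], not for [c] itself. So the slice at
    time [u] is bounded by continuity in space, and the mean value theorem in time propagates this
    with the bound on [dt c]. *)
Lemma C21_bounded u v r : 0 < u ->
  exists2 M : R, 0 <= M & forall x t, - r <= x <= r -> u <= t <= v -> `|c x t| <= M.
Proof.
move=> u0; have [M M0 HM] := C21_dt_bounded v r u0.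
have [cu _ _ _] := C21_continuous_slice u0.
have [N N0 HN] := continuous_segment_bounded (- r) r cu.
exists (N + M * `|v - u|); first by rewrite addr_ge0 ?mulr_ge0.
move=> x t xr /andP[]; rewrite le_eqVlt => /predU1P[<- _|ut tv].
  by rewrite ler_wpDr ?mulr_ge0// HN.
have [s /andP[us st] e] := @mean_value R (fun s => c x s) (dt c x) u t ut
  (fun s h => C21_dt x (lt_le_trans u0 (proj1 (andP h)))).
have -> : c x t = c x u + (c x t - c x u) by ring.
rewrite e (le_trans (ler_normD _ _))// lerD ?HN// normrM.
rewrite ler_pM// ?HM//.
  by rewrite (ltW us) (le_trans (ltW st)).
by rewrite !ger0_norm; lra.
Qed.

Variables (phi phix phixx : R -> R -> R) (u v C K : R).
(** The backward equation adjoint to [fokker_planck], solved for the time derivative of the test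
    function. *)
Let phit x t : R := (1 - x / Lam t) * phix x t - eps / 2 * phixx x t.
Hypothesis u_gt0 : 0 < u.
Hypothesis C_ge0 : 0 <= C.
Hypothesis phi_t : forall x t, u <= t <= v ->
  is_derive t 1 (fun s => phi x s) (phit x t).
Hypothesis phi_x : forall x t, u <= t <= v ->
  is_derive x 1 (fun y => phi y t) (phix x t).
Hypothesis phi_xx : forall x t, u <= t <= v ->
  is_derive x 1 (fun y => phix y t) (phixx x t).
Hypothesis phixx_continuous : forall t, u <= t <= v ->
  continuous (fun x => phixx x t).
Hypothesis bound : forall x t, u <= t <= v ->
  [/\ `|phi x t| <= C * (1 + `|x|), `|phix x t| <= C, `|phixx x t| <= C
    & `|(Lam t)^-1| <= C].
Hypothesis c_int : forall t, u <= t <= v ->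
  mu.-integrable [set: R] (fun x => ((1 + `|x|) * c x t)%:E).
Hypothesis c_bound : forall t, u <= t <= v ->
  \int[mu]_x ((1 + `|x|) * `|c x t|) <= K.

Section cutoff.
Variables (chi chi1 chi2 : R -> R) (r delta : R).
Hypothesis r_gt0 : 0 < r.
Hypothesis chi_1 : forall x, is_derive x 1 chi (chi1 x).
Hypothesis chi_2 : forall x, is_derive x 1 chi1 (chi2 x).
Hypothesis chi2_continuous : continuous chi2.
Hypothesis chi_r : [/\ chi r = 0, chi (- r) = 0, chi1 r = 0 & chi1 (- r) = 0].
Hypothesis chi_bound : forall x, - r <= x <= r ->
  [/\ `|chi x| <= 1, (1 + `|x|) * `|chi1 x| <= delta
    & (1 + `|x|) * `|chi2 x| <= delta].

Let F t : R := \int[mu]_(x in `[- r, r]) (c x t * phi x t * chi x).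
(** The commutator of the adjoint operator with multiplication by [chi]: the terms where [chi] is
    not differentiated cancel against [phit]. Each remaining term carries [chi1] or [chi2], hence a
    factor [delta]. *)
Let rest x t : R := - (1 - x / Lam t) * phi x t * chi1 x
  + eps * phix x t * chi1 x + eps / 2 * phi x t * chi2 x.
Let dF x t : R := dt c x t * phi x t * chi x + c x t * phit x t * chi x.

Let phi_slices t : u <= t <= v ->
  [/\ continuous (fun x => phi x t), continuous (fun x => phix x t)
    & continuous (fun x => phit x t)].
Proof.
move=> tuv; have hx : continuous (fun x => phix x t).
  by move=> x; exact: is_derive_continuous (phi_xx x tuv).
split=> //; first by move=> x; exact: is_derive_continuous (phi_x x tuv).
move=> x; apply: cvgB; apply: cvgM; [|exact: hx|exact: cvg_cst|exact: phixx_continuous].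
by apply: cvgB; [exact: cvg_cst|apply: cvgM; [exact: cvg_id|exact: cvg_cst]].
Qed.

Let chi_cont : continuous chi.
Proof. by move=> x; exact: is_derive_continuous (chi_1 x). Qed.

Let chi1_cont : continuous chi1.
Proof. by move=> x; exact: is_derive_continuous (chi_2 x). Qed.

Let is_derive_F t : u < t < v ->
  is_derive t 1 F (\int[mu]_(x in `[- r, r]) dF x t).
Proof.
have r0 := r_gt0; have e0 := eps_gt0; have C0 := C_ge0.
move=> tuv.
have [M M0 HM] := C21_dt_bounded v r u_gt0.
have [N N0 HN] := C21_bounded v r u_gt0.
pose G : R := M * (C * (1 + r)) + N * ((1 + r * C) * C + eps / 2 * C).
have uvW s : u < s < v -> u <= s <= v by move=> /andP[us sv]; rewrite !ltW.
have s0 s : u < s < v -> 0 < s by move=> /andP[us _]; exact: lt_trans us.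
apply: (@is_derive_Rintegral R (fun t x => c x t * phi x t * chi x)
  (fun t x => dF x t) `[- r, r] (fun=> G) t u v) => //.
- move=> s suv; apply: integrable_segment => x.
  have [cc _ _ _] := C21_continuous_slice (s0 _ suv).
  have [cp _ _] := phi_slices (uvW _ suv).
  by apply: cvgM; [apply: cvgM; [exact: cc|exact: cp]|exact: chi_cont].
- move=> s x suv _.
  apply: (is_derive_ceq _ (is_derive_fmul (is_derive_fmul
    (C21_dt x (s0 _ suv)) (phi_t x (uvW _ suv))) (is_derive_fconst (chi x) s))).
  by rewrite /dF; ring.
- have C1 : 0 <= C * (1 + r) by rewrite mulr_ge0//; lra.
  have C2 : 0 <= (1 + r * C) * C by rewrite mulr_ge0// addr_ge0// mulr_ge0// ltW.
  have C3 : 0 <= eps / 2 * C by rewrite mulr_ge0// divr_ge0// ltW.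
  by move=> _; rewrite /G addr_ge0// mulr_ge0// addr_ge0.
- by apply: integrable_segment => x; exact: cvg_cst.
- move=> s x suv; rewrite /= in_itv/= => xr.
  have [hc _ _] := chi_bound xr.
  have [h1 h2 h3 h4] := bound x (uvW _ suv).
  have xr' : `|x| <= r by rewrite ler_norml.
  have he : `|eps / 2| = eps / 2 by rewrite ger0_norm//; lra.
  have hp : `|phi x s| <= C * (1 + r).
    by rewrite (le_trans h1)// ler_wpM2l//; lra.
  have hpt : `|phit x s| <= (1 + r * C) * C + eps / 2 * C.
    rewrite /phit (le_trans (ler_normB _ _))// lerD// normrM; last first.
      by rewrite he ler_wpM2l//; lra.
    by rewrite ler_pM// (le_trans (ler_normB _ _))// normr1 lerD// normrM ler_pM.
  rewrite /dF /G (le_trans (ler_normD _ _))// lerD// -mulrA normrM.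
    by rewrite ler_pM ?HM ?uvW// normrM -[leRHS]mulr1 ler_pM.
  by rewrite ler_pM ?HN ?uvW// normrM -[leRHS]mulr1 ler_pM.
Qed.

Let integral_dF t : u < t < v -> `|\int[mu]_(x in `[- r, r]) dF x t| <=
  ((1 + C) * C + 2 * eps * C) * delta * K.
Proof.
have r0 := r_gt0; have e0 := eps_gt0; have C0 := C_ge0.
move=> /andP[ut tv]; have tuv : u <= t <= v by rewrite !ltW.
have t0 : 0 < t := lt_trans u_gt0 ut.
have [cc ct cx cxx] := C21_continuous_slice t0.
have [cp cpx cpt] := phi_slices tuv.
(* [J] is the flux, with [dt c] as its space derivative, and [Q] is the boundary term of the double
   integration by parts. The derivative of [Q] is the integrand minus [c] times the commutator, and
   [Q] vanishes at both ends because [chi] and [chi1] do. *)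
pose J x : R := (1 - x / Lam t) * c x t + eps / 2 * dx c x t.
pose eta x : R := phi x t * chi x.
pose etax x : R := phix x t * chi x + phi x t * chi1 x.
pose Q x : R := J x * eta x - eps / 2 * c x t * etax x.
have dQ x : is_derive x 1 Q (dF x t - c x t * rest x t).
  have dLam : is_derive x 1 (fun x => 1 - x / Lam t) (0 - (1 * (Lam t)^-1 + x * 0)).
    exact: is_derive_fsub (is_derive_fconst _ _)
      (is_derive_fmul (is_derive_fid _) (is_derive_fconst _ _)).
  have hp := phi_x x tuv; have hpx := phi_xx x tuv.
  have hc := C21_dx x t0; have hcx := C21_dxx x t0.
  apply: (is_derive_ceq _ (is_derive_fsub (is_derive_fmul
    (is_derive_fadd (is_derive_fmul dLam hc)
       (is_derive_fmul (is_derive_fconst (eps / 2) x) hcx))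
    (is_derive_fmul hp (chi_1 x)))
    (is_derive_fmul (is_derive_fmul (is_derive_fconst (eps / 2) x) hc)
      (is_derive_fadd (is_derive_fmul hpx (chi_1 x)) (is_derive_fmul hp (chi_2 x)))))).
  rewrite /dF /rest /phit fokker_planck//=; move: (Lam t)^-1 => L; by field.
have c1L : continuous (fun x => 1 - x / Lam t).
  by move=> x; apply: cvgB; [exact: cvg_cst|apply: cvgM; [exact: cvg_id|exact: cvg_cst]].
have crest : continuous (fun x => c x t * rest x t).
  move=> x; apply: cvgM; first exact: cc.
  apply: cvgD; first apply: cvgD; (apply: cvgM; first apply: cvgM).
  - by apply: cvgN; exact: c1L.
  - exact: cp.
  - exact: chi1_cont.
  - exact: cvg_cst.
  - exact: cpx.
  - exact: chi1_cont.
  - exact: cvg_cst.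
  - exact: cp.
  - exact: chi2_continuous.
have cdF : continuous (fun x => dF x t).
  move=> x; apply: cvgD; (apply: cvgM; [apply: cvgM|exact: chi_cont]).
  - exact: ct.
  - exact: cp.
  - exact: cc.
  - exact: cpt.
have -> : \int[mu]_(x in `[- r, r]) dF x t =
    \int[mu]_(x in `[- r, r]) (c x t * rest x t).
  apply/eqP; rewrite -subr_eq0 -RintegralB//; [|exact: integrable_segment..].
  rewrite (Rintegral_derivative _ dQ); last 2 first.
  - lra.
  - by move=> x; apply: cvgB; [exact: cdF|exact: crest].
  have [e1 e2 e3 e4] := chi_r.
  by rewrite /Q /eta /etax e1 e2 e3 e4 !mulr0 !addr0 !mulr0 !subrr.
have ri := integrable_segment (- r) r crest.
rewrite (le_trans (le_normr_Rintegral _ ri))//.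
pose D : R := ((1 + C) * C + 2 * eps * C) * delta.
have N_int : mu.-integrable [set: R] (EFin \o (fun x => (1 + `|x|) * `|c x t|)).
  rewrite (_ : _ \o _ = abse \o (fun x => ((1 + `|x|) * c x t)%:E)).
    exact/integrable_abse/c_int.
  by apply/funext => x /=; rewrite normrM [`|1 + _|]ger0_norm.
have N_int' : mu.-integrable [set: R] (EFin \o (fun x => D * ((1 + `|x|) * `|c x t|))).
  rewrite (_ : _ \o _ = (fun x => D%:E * ((1 + `|x|) * `|c x t|)%:E)%E).
    exact: integrableZl.
  by apply/funext => x /=; rewrite EFinM.
have delta0 : 0 <= delta.
  have [|_ h _] := @chi_bound 0; first by rewrite oppr_le0 ltW.
  by apply: le_trans h; rewrite mulr_ge0.
have D0 : 0 <= D.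
  rewrite /D mulr_ge0//.
  by have := mulr_ge0 C0 C0; have := mulr_ge0 (ltW e0) C0; lra.
apply: (@le_trans _ _ (\int[mu]_(x in `[- r, r]) (D * ((1 + `|x|) * `|c x t|)))).
  apply: le_Rintegral => //.
  - apply: integrable_segment => x.
    by apply: cvg_norm; exact: crest.
  - exact: (integrableS measurableT _ _ N_int').
  move=> x; rewrite /= in_itv/= => xr.
  have [_ hc1 hc2] := chi_bound xr.
  have [h1 h2 h3 h4] := bound x tuv.
  have x0 := normr_ge0 x.
  rewrite normrM [leLHS]mulrC mulrA ler_wpM2r//.
  have c1d : `|chi1 x| <= delta.
    by rewrite (le_trans _ hc1)// -[leLHS]mul1r ler_wpM2r//; lra.
  (* The worst term: drift and [phi] both grow linearly and produce the square of the weight. One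
     weight is spent on [chi1] and yields [delta]; the other stays with [|c|]. *)
  have a1 : `|- (1 - x / Lam t) * phi x t * chi1 x| <= (1 + `|x|) * ((1 + C) * C) * delta.
    rewrite !normrM normrN.
    have -> : (1 + `|x|) * ((1 + C) * C) * delta = (1 + C) * C * (1 + `|x|) * delta by ring.
    apply: (@le_trans _ _ ((1 + C) * (1 + `|x|) * (C * (1 + `|x|)) * `|chi1 x|)).
      rewrite ler_wpM2r// ler_pM// (le_trans (ler_normB _ _))// normr1 normrM.
      have := ler_wpM2l x0 h4; have := mulr_ge0 x0 C_ge0; lra.
    have -> : (1 + C) * (1 + `|x|) * (C * (1 + `|x|)) * `|chi1 x| =
      (1 + C) * C * (1 + `|x|) * ((1 + `|x|) * `|chi1 x|) by ring.
    rewrite ler_wpM2l// !mulr_ge0//; lra.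
  have a2 : `|eps * phix x t * chi1 x| <= (1 + `|x|) * (eps * C) * delta.
    rewrite !normrM (gtr0_norm eps_gt0).
    apply: (@le_trans _ _ (eps * C * delta)).
      by rewrite ler_pM ?mulr_ge0 ?(ltW eps_gt0)// ler_wpM2l// ltW.
    rewrite ler_wpM2r// -[leLHS]mul1r ler_wpM2r//; [|lra].
    by rewrite mulr_ge0// ltW.
  have a3 : `|eps / 2 * phi x t * chi2 x| <= (1 + `|x|) * (eps * C) * delta.
    rewrite normrM [`|eps / 2 * _|]normrM (gtr0_norm (_ : 0 < eps / 2)) ?divr_gt0//.
    apply: (@le_trans _ _ (eps / 2 * (C * (1 + `|x|)) * `|chi2 x|)).
      by rewrite ler_wpM2r// ler_wpM2l// ltW// divr_gt0.
    have -> : eps / 2 * (C * (1 + `|x|)) * `|chi2 x| =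
      eps / 2 * C * ((1 + `|x|) * `|chi2 x|) by ring.
    have eC0 := mulr_ge0 (ltW eps_gt0) C_ge0.
    apply: ler_pM hc2; first lra.
      by rewrite mulr_ge0//; lra.
    by have := mulr_ge0 x0 eC0; lra.
  rewrite /rest (le_trans (ler_normD _ _))//.
  rewrite (le_trans (lerD (ler_normD _ _) (lexx _)))//.
  have -> : D * (1 + `|x|) = (1 + `|x|) * ((1 + C) * C) * delta +
    (1 + `|x|) * (eps * C) * delta + (1 + `|x|) * (eps * C) * delta by rewrite /D; ring.
  by rewrite !lerD.
apply: (@le_trans _ _ (\int[mu]_x (D * ((1 + `|x|) * `|c x t|)))).
  apply: ge0_Rintegral_subset => // x.
  by have x0 := normr_ge0 x; rewrite mulr_ge0// mulr_ge0//; lra.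
rewrite RintegralZl// ler_wpM2l//; exact: c_bound.
Qed.

Lemma cutoff_integral_lipschitz t1 t2 : u < t1 -> t1 < t2 -> t2 < v ->
  `|F t2 - F t1| <= ((1 + C) * C + 2 * eps * C) * delta * K * (t2 - t1).
Proof.
move=> ut1 t12 t2v.
have [|s /andP[t1s st2] ->] := @mean_value R F
  (fun t => \int[mu]_(x in `[- r, r]) dF x t) t1 t2 t12.
  move=> s /andP[t1s st2]; apply: is_derive_F.
  by rewrite (lt_le_trans ut1)// (le_lt_trans st2).
rewrite normrM [`|t2 - t1|]ger0_norm; last lra.
rewrite ler_wpM2r//; first lra.
by apply: integral_dF; rewrite (lt_trans ut1)// (lt_trans st2).
Qed.

End cutoff.
End weak_formulation.

(** * Integrability with respect to the weight [1 + |x|] *)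

Section weighted_integrals.
Context {R : realType}.
Local Notation mu := (@lebesgue_measure R).
Implicit Types (f g h : R -> R) (a b k r s t u v x y : R).

Definition weighted_integrable f :=
  mu.-integrable [set: R] (fun x => ((1 + `|x|) * f x)%:E).

Lemma weight_gt0 x : 0 < 1 + `|x|.
Proof. by rewrite ltr_pwDl. Qed.

Lemma weight_ge1 x : 1 <= 1 + `|x|.
Proof. by rewrite lerDl. Qed.

Lemma weighted_integrable_measurable f : weighted_integrable f ->
  measurable_fun [set: R] f.
Proof.
move=> /measurable_int/measurable_EFinP mf.
rewrite (_ : f = (fun x => (1 + `|x|)^-1 * ((1 + `|x|) * f x))); last first.
  by apply/funext => x; rewrite mulrA mulVf ?mul1r// gt_eqF// weight_gt0.
apply: measurable_funM => //; apply: continuous_measurable_fun => x.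
apply: cvgV; first by rewrite gt_eqF// weight_gt0.
by apply: cvgD; [exact: cvg_cst|exact: norm_continuous].
Qed.

Lemma weighted_integrable_norm f : weighted_integrable f ->
  mu.-integrable [set: R] (EFin \o (fun x => (1 + `|x|) * `|f x|)).
Proof.
move=> fi.
rewrite (_ : _ \o _ = abse \o (fun x => ((1 + `|x|) * f x)%:E)).
  exact: integrable_abse.
by apply/funext => x /=; rewrite normrM [`|1 + _|]ger0_norm// ltW// weight_gt0.
Qed.

Lemma weighted_integrable_dominated f g k : weighted_integrable f ->
  measurable_fun [set: R] g -> (forall x, `|g x| <= k * ((1 + `|x|) * `|f x|)) ->
  mu.-integrable [set: R] (EFin \o g).
Proof.
move=> fi mg gk.
have gi : mu.-integrable [set: R] (EFin \o (fun x => k * ((1 + `|x|) * `|f x|))).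
  rewrite (_ : _ \o _ = (fun x => k%:E * ((1 + `|x|) * `|f x|)%:E)%E).
    exact/integrableZl/weighted_integrable_norm.
  by apply/funext => x /=; rewrite EFinM.
apply: (le_integrable measurableT _ _ gi); first exact/measurable_EFinP.
by move=> x _ /=; rewrite lee_fin (le_trans (gk x))// ler_norm.
Qed.

Lemma weighted_integrableM f h k : weighted_integrable f ->
  measurable_fun [set: R] h -> (forall x, `|h x| <= k * (1 + `|x|)) ->
  mu.-integrable [set: R] (EFin \o (fun x => f x * h x)).
Proof.
move=> fi mh hk; apply: (weighted_integrable_dominated (k := k) fi).
  by apply: measurable_funM => //; exact: weighted_integrable_measurable.
move=> x; rewrite normrM [leLHS]mulrC mulrA ler_wpM2r//.
Qed.

Lemma cvg_Rintegral_dominated (f_ : nat -> R -> R) f g :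
  (forall n, measurable_fun [set: R] (f_ n)) -> measurable_fun [set: R] f ->
  (\forall x \ae mu, f_ n x @[n --> \oo] --> f x) ->
  mu.-integrable [set: R] (EFin \o g) ->
  (forall n x, `|f_ n x| <= g x) ->
  \int[mu]_x f_ n x @[n --> \oo] --> \int[mu]_x f x.
Proof.
move=> mf_ mf ff ig fg.
have [||||fi _ cv] := @dominated_convergence _ _ _ mu setT measurableT
  (fun n => EFin \o f_ n) (EFin \o f) (EFin \o g) _ _ _ ig _.
- move=> n; have /measurable_EFinP h := mf_ n; exact: h.
- exact/measurable_EFinP.
- case: ff => N [mN N0 hN]; exists N; split => // x /= hx; apply: hN => /= hf.
  by apply: hx => _; apply: cvg_EFin => //; exact: nearW.
- by apply/aeW => x n _; rewrite lee_fin.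
apply: fine_cvg; rewrite fineK; last exact: integrable_fin_num.
exact: cv.
Qed.

End weighted_integrals.

Section log_cutoff.
Context {R : realType}.
Implicit Types (l r x : R).

(* A logarithmic cutoff: [(1 + |x|) |chi'|] and [(1 + |x|) |chi''|] are O(1/l)
   uniformly on its support [|x| <= chi_radius l], which a rescaled bump function
   would not achieve; this accommodates test functions of linear growth. *)
Definition logw x : R := ln (1 + x ^+ 2).
Definition logw1 x : R := 2 * x / (1 + x ^+ 2).
Definition logw2 x : R := (2 - 2 * x ^+ 2) / (1 + x ^+ 2) ^+ 2.
(** The square makes both [chi] and its derivative vanish at the radius, where [logw] equals [l].
    Beyond the radius [chi] grows again, so it is only ever integrated over the segment. *)
Definition chi l x : R := (1 - logw x / l) ^+ 2.
Definition chi1 l x : R := - 2 * (1 - logw x / l) * (logw1 x / l).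
Definition chi2 l x : R :=
  2 * (logw1 x / l) ^+ 2 - 2 * (1 - logw x / l) * (logw2 x / l).
Definition chi_radius l : R := Num.sqrt (expR l - 1).

Let D x : R := 1 + x ^+ 2.
Let D_gt0 x : 0 < D x. Proof. by rewrite ltr_pwDl// sqr_ge0. Qed.

Lemma is_derive_logw x : is_derive x 1 logw (logw1 x).
Proof.
apply: (is_derive_ceq _ (is_derive_fln (D_gt0 x)
  (is_derive_fadd (is_derive_fconst 1 x) (is_derive_fsqr (is_derive_fid x))))).
by rewrite add0r mulr1.
Qed.

Lemma is_derive_logw1 x : is_derive x 1 logw1 (logw2 x).
Proof.
have h := D_gt0 x.
have hD : is_derive x 1 D (0 + 2 * x * 1).
  exact: is_derive_fadd (is_derive_fconst 1 x) (is_derive_fsqr (is_derive_fid x)).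
apply: (is_derive_ceq _ (is_derive_fmul
  (is_derive_fmul (is_derive_fconst 2 x) (is_derive_fid x))
  (is_derive_finv _ hD))); last by rewrite gt_eqF.
by rewrite /logw2 /D; field; rewrite gt_eqF.
Qed.

Variable l : R.
Hypothesis l_ge1 : 1 <= l.

Let u_deriv x : is_derive x 1 (fun y => 1 - logw y / l) (- (logw1 x / l)).
Proof.
apply: (is_derive_ceq _ (is_derive_fsub (is_derive_fconst 1 x)
  (is_derive_fmul (is_derive_logw x) (is_derive_fconst (l^-1) x)))).
by ring.
Qed.

Lemma is_derive_chi x : is_derive x 1 (chi l) (chi1 l x).
Proof.
apply: (is_derive_ceq _ (is_derive_fsqr (u_deriv x))).
by rewrite /chi1; ring.
Qed.

Lemma is_derive_chi1 x : is_derive x 1 (chi1 l) (chi2 l x).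
Proof.
apply: (is_derive_ceq _ (is_derive_fmul
  (is_derive_fmul (is_derive_fconst (- 2) x) (u_deriv x))
  (is_derive_fmul (is_derive_logw1 x) (is_derive_fconst (l^-1) x)))).
by rewrite /chi2; ring.
Qed.

Lemma continuous_chi2 : continuous (chi2 l).
Proof.
have c1 : continuous (fun y => 1 - logw y / l).
  by move=> y; exact: is_derive_continuous (u_deriv y).
have c2 : continuous (fun y => logw1 y / l).
  move=> y; apply: cvgM; last exact: cvg_cst.
  exact: is_derive_continuous (is_derive_logw1 y).
have csq (f : R -> R) : continuous f -> continuous (fun y => f y ^+ 2).
  by move=> cf y; apply: cvgM; exact: cf.
have c3 : continuous (fun y => logw2 y / l).
  have cx2 : continuous (fun y : R => y ^+ 2) by apply: csq => y; exact: cvg_id.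
  move=> y; apply: cvgM; last exact: cvg_cst.
  apply: cvgM.
    by apply: cvgB; [exact: cvg_cst|apply: cvgM; [exact: cvg_cst|exact: cx2]].
  apply: cvgV; first by rewrite gt_eqF// exprn_gt0// D_gt0.
  apply: (csq (fun y => 1 + y ^+ 2)) => z.
  by apply: cvgD; [exact: cvg_cst|exact: cx2].
move=> x; apply: cvgB.
  by apply: cvgM; [exact: cvg_cst|exact: (csq (fun y => logw1 y / l))].
by apply: cvgM; [apply: cvgM; [exact: cvg_cst|exact: c1]|exact: c3].
Qed.

Let r := chi_radius l.

Lemma chi_radius_gt0 : 0 < r.
Proof.
have h := l_ge1; rewrite sqrtr_gt0 subr_gt0 expR_gt1; lra.
Qed.

Let logw_le x : - r <= x <= r -> 0 <= logw x <= l.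
Proof.
move=> /andP[xr1 xr2]; have x0 := sqr_ge0 x.
have : x ^+ 2 <= r ^+ 2.
  by rewrite -[x ^+ 2]real_normK ?num_real// lerXn2r ?nnegrE ?ler_norml ?xr1//
    ?sqrtr_ge0.
rewrite sqr_sqrtr; last by rewrite subr_ge0 (le_trans _ (expR_ge1Dx _))//; have h := l_ge1; lra.
move=> xl; rewrite /logw ln_ge0/=; last by lra.
by rewrite -[leRHS]expRK ler_ln ?posrE ?expR_gt0//; [lra|exact: D_gt0].
Qed.

Let logw_r : logw r = l.
Proof.
rewrite /logw /r /chi_radius sqr_sqrtr; first by rewrite addrC subrK expRK.
by rewrite subr_ge0 (le_trans _ (expR_ge1Dx _))//; have h := l_ge1; lra.
Qed.

Lemma chi_at_radius :
  [/\ chi l r = 0, chi l (- r) = 0, chi1 l r = 0 & chi1 l (- r) = 0].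
Proof.
have l0 : l != 0 by rewrite gt_eqF//; have := l_ge1; lra.
have logwN : logw (- r) = l by rewrite -logw_r /logw sqrrN.
by rewrite /chi /chi1 logwN logw_r divff// subrr expr0n/= !(mulr0, mul0r).
Qed.

(** With the weight, [logw1] and [logw2] are both bounded by 3, and [|logw1| <= 1]. The first
    derivative costs [6 / l] and the second [6 / l ^+ 2 + 6 / l]; since [1 <= l], [12 / l] covers
    both. *)
Lemma chi_bounds x : - r <= x <= r ->
  [/\ 0 <= chi l x <= 1, (1 + `|x|) * `|chi1 l x| <= 12 / l
    & (1 + `|x|) * `|chi2 l x| <= 12 / l].
Proof.
move=> /logw_le/andP[w0 wl].
have l1 := l_ge1; have l0 : 0 < l by lra.
have li0 : 0 < l^-1 by rewrite invr_gt0.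
have li1 : l^-1 <= 1 by rewrite invf_le1//.
have q0 : 0 <= 1 - logw x / l by rewrite subr_ge0 ler_pdivrMr// mul1r.
have q1 : 1 - logw x / l <= 1 by rewrite gerBl divr_ge0// ltW.
have d0 := D_gt0 x.
have x0 := normr_ge0 x.
have x2 : `|x| ^+ 2 = x ^+ 2 by rewrite real_normK ?num_real.
have sq := sqr_ge0 (`|x| - 1).
have xD : 2 * `|x| <= D x by rewrite /D -x2; lra.
have w1 : `|logw1 x| <= 1.
  rewrite /logw1 normrM normfV (gtr0_norm d0) ler_pdivrMr// mul1r normrM.
  by rewrite (ger0_norm (ler0n _ 2)).
have w1' : (1 + `|x|) * `|logw1 x| <= 3.
  rewrite /logw1 normrM normfV (gtr0_norm d0) mulrA ler_pdivrMr// normrM.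
  by rewrite (ger0_norm (ler0n _ 2)); rewrite /D -x2; lra.
have w2' : (1 + `|x|) * `|logw2 x| <= 3.
  rewrite /logw2 normrM normfV normrX (gtr0_norm d0).
  have : `|2 - 2 * x ^+ 2| <= 2 * D x.
    by rewrite ler_norml /D; have := sqr_ge0 x; lra.
  move=> h; rewrite mulrA ler_pdivrMr ?exprn_gt0//.
  apply: (@le_trans _ _ ((3 / 2 * D x) * (2 * D x))).
    have D1 : 1 <= D x by rewrite /D lerDl sqr_ge0.
    by apply: ler_pM => //; lra.
  by have -> : 3 / 2 * D x * (2 * D x) = 3 * D x ^+ 2 by field.
rewrite /chi1 /chi2.
move: (logw1 x) (logw2 x) w1 w1' w2' => p q w1 w1' w2'.
split.
- by rewrite /chi sqr_ge0 expr_le1.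
- rewrite !normrM normrN (ger0_norm (ler0n _ 2)) (ger0_norm q0).
  rewrite (gtr0_norm li0).
  have -> : (1 + `|x|) * (2 * (1 - logw x / l) * (`|p| / l)) =
    (1 - logw x / l) * (2 * ((1 + `|x|) * `|p|) / l) by field; rewrite gt_eqF.
  rewrite -[leRHS]mul1r ler_pM//; first by rewrite divr_ge0// ?(ltW l0)// !mulr_ge0//; lra.
  by rewrite ler_pM2r//; lra.
- apply: (@le_trans _ _ ((1 + `|x|) *
    (2 * (`|p| / l) ^+ 2 + 2 * (1 - logw x / l) * (`|q| / l)))).
    apply: ler_wpM2l; first lra.
    rewrite (le_trans (ler_normB _ _))//.
    by rewrite !(normrM, normrX) !normfV (ger0_norm (ler0n _ 2)) (ger0_norm q0) (gtr0_norm l0).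
  have -> : (1 + `|x|) *
    (2 * (`|p| / l) ^+ 2 + 2 * (1 - logw x / l) * (`|q| / l)) =
    2 * ((1 + `|x|) * `|p|) * (`|p| * l^-1) / l +
    2 * (1 - logw x / l) * ((1 + `|x|) * `|q|) / l by field; rewrite gt_eqF.
  have -> : 12 / l = 6 / l + 6 / l by field; rewrite gt_eqF.
  apply: lerD; rewrite ler_pM2r//.
    rewrite -[leRHS]mulr1; apply: ler_pM; last 2 first.
    + by lra.
    + by rewrite -[leRHS]mulr1 ler_pM// ltW.
    + by rewrite mulr_ge0// mulr_ge0//; lra.
    + by rewrite mulr_ge0// ltW.
  have -> : 6 = 2 * 1 * 3 :> R by ring.
  apply: ler_pM w2'; first by rewrite mulr_ge0.
    by rewrite mulr_ge0//; lra.
  by rewrite ler_wpM2l.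
Qed.

End log_cutoff.

(** * Removing the cutoff *)

Section weak_conservation.
Context {R : realType}.
Local Notation mu := (@lebesgue_measure R).
Implicit Types (f g h : R -> R) (a b k r s t u v x y : R).

Lemma cvg_Rintegral_log_cutoff f h k : weighted_integrable f ->
  measurable_fun [set: R] h -> (forall x, `|h x| <= k * (1 + `|x|)) ->
  \int[mu]_(x in `[- chi_radius n.+1%:R, chi_radius n.+1%:R])
     (f x * h x * chi n.+1%:R x) @[n --> \oo] --> \int[mu]_x (f x * h x).
Proof.
move=> fi mh hk; have mf := weighted_integrable_measurable fi.
have n1 n : 1 <= n.+1%:R :> R by rewrite ler1n.
under eq_cvg do rewrite Rintegral_mkcond.
apply: (@cvg_Rintegral_dominated _ _ _ (fun x => k * ((1 + `|x|) * `|f x|))).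
- move=> n; have mchi : measurable_fun [set: R] (chi n.+1%:R).
    apply: continuous_measurable_fun => x.
    exact: is_derive_continuous (is_derive_chi _ x).
  have m := measurable_funM (measurable_funM mf mh) mchi.
  have mr : measurable_fun `[- chi_radius n.+1%:R, chi_radius n.+1%:R]
    (fun x => f x * h x * chi n.+1%:R x) by exact: measurable_funTS m.
  exact: (proj1 (measurable_restrictT _ (measurable_itv _)) mr).
- exact: measurable_funM.
- apply/aeW => x.
  have hchi : chi n.+1%:R x @[n --> \oo] --> (1 : R).
    rewrite [X in _ --> X](_ : 1 = (1 - logw x * 0) * (1 - logw x * 0)); last by ring.
    have hu : 1 - logw x / n.+1%:R @[n --> \oo] --> 1 - logw x * 0.
      apply: cvgB; first exact: cvg_cst.
      by apply: cvgM; [exact: cvg_cst|exact: cvg_harmonic].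
    exact: (cvgM hu hu).
  have H : f x * h x * chi n.+1%:R x @[n --> \oo] --> f x * h x * 1.
    by apply: cvgM; first exact: cvg_cst.
  rewrite mulr1 in H.
  apply: cvg_trans H.
  (* As soon as [x ^+ 2 <= n], the point lies within the radius, by
     [1 + x ^+ 2 <= 1 + n.+1 <= expR n.+1]. *)
  apply: near_eq_cvg; near=> n; rewrite patchE ifT//.
  rewrite inE/= in_itv/= -ler_norml /chi_radius -sqrtr_sqr ler_wsqrtr//.
  rewrite lerBrDl (le_trans _ (expR_ge1Dx _))// lerD2l.
  apply: (@le_trans _ _ n%:R); last by rewrite ler_nat.
  by near: n; exact: nbhs_infty_ger.
- rewrite (_ : _ \o _ = (fun x => k%:E * ((1 + `|x|) * `|f x|)%:E)%E).
    exact/integrableZl/weighted_integrable_norm.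
  by apply/funext => x /=; rewrite EFinM.
move=> n x; have k0 : 0 <= k * ((1 + `|x|) * `|f x|).
  rewrite mulrA mulr_ge0//; exact: le_trans (hk x).
rewrite patchE; case: ifPn => [|_]; last by rewrite normr0.
rewrite inE/= in_itv/= => xr.
have [/andP[c0 c1] _ _] := chi_bounds (n1 n) xr.
have fh : `|f x * h x| <= k * ((1 + `|x|) * `|f x|).
  by rewrite normrM mulrC mulrA ler_wpM2r.
by rewrite normrM (ger0_norm c0) -[leRHS]mulr1 ler_pM.
Unshelve. all: end_near. Qed.

Lemma weak_conservation (eps : R) (c : R -> R -> R) (Lam : R -> R)
    (phi phix phixx : R -> R -> R) u v k K :
  0 < eps -> C21 c ->
  (forall x t, 0 < t ->
    dt c x t = dx (fun y s => (1 - y / Lam s) * c y s) x t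
               + eps / 2 * dx (dx c) x t) ->
  0 < u -> 0 <= k ->
  (forall x t, u <= t <= v -> is_derive t 1 (fun s => phi x s)
    ((1 - x / Lam t) * phix x t - eps / 2 * phixx x t)) ->
  (forall x t, u <= t <= v -> is_derive x 1 (fun y => phi y t) (phix x t)) ->
  (forall x t, u <= t <= v -> is_derive x 1 (fun y => phix y t) (phixx x t)) ->
  (forall t, u <= t <= v -> continuous (fun x => phixx x t)) ->
  (forall x t, u <= t <= v ->
    [/\ `|phi x t| <= k * (1 + `|x|), `|phix x t| <= k, `|phixx x t| <= k
      & `|(Lam t)^-1| <= k]) ->
  (forall t, u <= t <= v -> weighted_integrable (fun x => c x t)) ->
  (forall t, u <= t <= v -> \int[mu]_x ((1 + `|x|) * `|c x t|) <= K) ->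
  forall t1 t2, u < t1 -> t1 < t2 -> t2 < v ->
  \int[mu]_x (c x t1 * phi x t1) = \int[mu]_x (c x t2 * phi x t2).
Proof.
move=> eps0 cC pde u0 k0 phi_t phi_x phi_xx phixx_c bnd c_int c_bnd t1 t2 ut1 t12 t2v.
pose F n t : R := \int[mu]_(x in `[- chi_radius n.+1%:R, chi_radius n.+1%:R])
     (c x t * phi x t * chi n.+1%:R x).
have n1 n : 1 <= n.+1%:R :> R by rewrite ler1n.
have cvgF t : u < t < v -> F n t @[n --> \oo] --> \int[mu]_x (c x t * phi x t).
  move=> /andP[ut tv]; have tuv : u <= t <= v by rewrite !ltW.
  apply: (@cvg_Rintegral_log_cutoff _ _ k); first exact: c_int.
    by apply: continuous_measurable_fun => x; exact: is_derive_continuous (phi_x x t tuv).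
  by move=> x; have [] := bnd x t tuv.
have h1 : F n t2 - F n t1 @[n --> \oo] --> \int[mu]_x (c x t2 * phi x t2) -
    \int[mu]_x (c x t1 * phi x t1).
  by apply: cvgB; apply: cvgF; rewrite ?ut1 ?t2v ?(lt_trans ut1 t12) ?(lt_trans t12 t2v).
pose B : R := ((1 + k) * k + 2 * eps * k) * 12 * K * (t2 - t1).
(* Here [delta = 12 / n.+1]: the localised integral varies between the two times by at most [B] over
   [n.+1], so its limit takes equal values at [t1] and [t2]. *)
have h2 : F n t2 - F n t1 @[n --> \oo] --> (0 : R).
  apply: norm_cvg0.
  apply: (@squeeze_cvgr _ _ _ _ (fun=> 0) (fun n => B * harmonic n)).
  - apply: nearW => n; rewrite normr_ge0/=.
    apply: (le_trans (@cutoff_integral_lipschitz R eps c Lam eps0 cC pde phi phix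
      phixx u v k K u0 k0 phi_t phi_x phi_xx phixx_c bnd c_int c_bnd (chi n.+1%:R)
      (chi1 n.+1%:R) (chi2 n.+1%:R) (chi_radius n.+1%:R) (12 / n.+1%:R) _ _ _ _ _ _
      t1 t2 ut1 t12 t2v)).
    + exact: chi_radius_gt0.
    + by move=> x; exact: is_derive_chi.
    + by move=> x; exact: is_derive_chi1.
    + exact: continuous_chi2.
    + exact: chi_at_radius.
    + move=> x xr; have [/andP[c0 c1] h3 h4] := chi_bounds (n1 n) xr.
      by split => //; rewrite ger0_norm.
    + by rewrite /B /harmonic/= le_eqVlt; apply/orP; left; apply/eqP; ring.
  - exact: cvg_cst.
  - rewrite -[X in _ --> X](mulr0 B); apply: cvgM; first exact: cvg_cst.
    exact: cvg_harmonic.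
apply/esym/eqP; rewrite -subr_eq0; apply/eqP.
exact: (norm_cvg_unique h1 h2).
Qed.

End weak_conservation.

(** * Explicit solutions of the heat equation *)

Section heat_solutions.
Context {R : realType}.
Implicit Types (k r s t w x z : R).

(* [psi] solves [psi_w = psi_zz / 2] for [w > 0] with initial data [psi0]. *)
Record heat_solution (psi psiz psizz : R -> R -> R) (psi0 : R -> R) : Prop :=
  HeatSolution {
  heat_chain : forall (zeta omega : R -> R) t z1 w1, 0 < omega t ->
    is_derive t 1 zeta z1 -> is_derive t 1 omega w1 ->
    is_derive t 1 (fun s => psi (zeta s) (omega s))
      (psiz (zeta t) (omega t) * z1 + psizz (zeta t) (omega t) / 2 * w1);
  heat_zz : forall z w, 0 < w -> is_derive z 1 (fun y => psiz y w) (psizz z w);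
  heat_zz_continuous : forall w, 0 < w -> continuous (fun z => psizz z w);
  heat_bound : forall d : R, 0 < d -> exists2 k : R, 0 <= k & forall z w, d <= w ->
    `|psiz z w| <= k /\ `|psizz z w| <= k;
  heat_growth : forall W : R, exists2 k : R, 0 <= k & forall z w, 0 < w <= W ->
    `|psi z w| <= k * (1 + `|z|);
  heat_init : forall z w, z != 0 -> 0 < w ->
    `|psi z w - psi0 z| <= Num.sqrt w * (1 + `|z|^-1);
  heat_init_continuous : forall z, z != 0 -> {for z, continuous psi0};
  heat_init_measurable : measurable_fun [set: R] psi0 }.

(** Up to the factor [kap], these are the Gaussian distribution function of variance [w], the
    smoothed positive part, the heat kernel and its derivative. In the order [heatE], [heatP],
    [heatG], [heatGz], each is the [z]-derivative of the one before, so consecutive triples form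
    heat solutions. *)
Definition heatP z w : R := Phi (z / Num.sqrt w).
Definition heatE z w : R := Num.sqrt w * E1 (z / Num.sqrt w).
Definition heatG z w : R := gauss (z / Num.sqrt w) / Num.sqrt w.
Definition heatGz z w : R := - (z / w) * heatG z w.

Lemma is_derive_ratio_sqrt (zeta omega : R -> R) t z1 w1 : 0 < omega t ->
  is_derive t 1 zeta z1 -> is_derive t 1 omega w1 ->
  is_derive t 1 (fun s => zeta s / Num.sqrt (omega s))
    (z1 / Num.sqrt (omega t) -
       zeta t / (2 * Num.sqrt (omega t) * omega t) * w1).
Proof.
move=> w0 hz hw; have s0 : 0 < Num.sqrt (omega t) by rewrite sqrtr_gt0.
have sE : omega t = Num.sqrt (omega t) ^+ 2 by rewrite sqr_sqrtr// ltW.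
apply: (is_derive_ceq _ (is_derive_fmul hz
  (is_derive_finv _ (is_derive_fsqrt w0 hw)))); last by rewrite gt_eqF.
move: (Num.sqrt (omega t)) sE s0 => s -> s0.
by field; rewrite gt_eqF.
Qed.

(** A chain rule along a curve holds all that is needed: a constant [omega] gives the
    [z]-derivative, and the coefficient of [w1], half the second [z]-derivative, is the heat
    equation. *)
Lemma heatP_chain (zeta omega : R -> R) t z1 w1 : 0 < omega t ->
  is_derive t 1 zeta z1 -> is_derive t 1 omega w1 ->
  is_derive t 1 (fun s => heatP (zeta s) (omega s))
    (heatG (zeta t) (omega t) * z1 + heatGz (zeta t) (omega t) / 2 * w1).
Proof.
move=> w0 hz hw; have s0 : 0 < Num.sqrt (omega t) by rewrite sqrtr_gt0.
apply: (is_derive_ceq _ (is_derive_fcomp (is_derive_Phi _)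
  (is_derive_ratio_sqrt w0 hz hw))).
by rewrite /heatGz /heatG; field; rewrite !gt_eqF.
Qed.

(** The contributions of [omega] collapse to the kernel because [E1 a - a * Phi a = gauss a]. *)
Lemma heatE_chain (zeta omega : R -> R) t z1 w1 : 0 < omega t ->
  is_derive t 1 zeta z1 -> is_derive t 1 omega w1 ->
  is_derive t 1 (fun s => heatE (zeta s) (omega s))
    (heatP (zeta t) (omega t) * z1 + heatG (zeta t) (omega t) / 2 * w1).
Proof.
move=> w0 hz hw; have s0 : 0 < Num.sqrt (omega t) by rewrite sqrtr_gt0.
have sE : omega t = Num.sqrt (omega t) ^+ 2 by rewrite sqr_sqrtr// ltW.
apply: (is_derive_ceq _ (is_derive_fmul (is_derive_fsqrt w0 hw)
  (is_derive_fcomp (is_derive_E1 _) (is_derive_ratio_sqrt w0 hz hw)))).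
rewrite /heatP /heatG /E1; move: (Num.sqrt (omega t)) sE s0 => s -> s0.
by field; rewrite gt_eqF.
Qed.

Lemma heatG_z z w : 0 < w -> is_derive z 1 (fun y => heatG y w) (heatGz z w).
Proof.
move=> w0; have s0 : 0 < Num.sqrt w by rewrite sqrtr_gt0.
have sE : w = Num.sqrt w ^+ 2 by rewrite sqr_sqrtr// ltW.
apply: (is_derive_ceq _ (is_derive_fmul (is_derive_fcomp (is_derive_gauss _)
  (is_derive_fmul (is_derive_fid z) (is_derive_fconst (Num.sqrt w)^-1 z)))
  (is_derive_fconst (Num.sqrt w)^-1 z))).
rewrite /heatGz /heatG; move: (Num.sqrt w) sE s0 => s -> s0.
by field; rewrite gt_eqF.
Qed.

Lemma heatP_z z w : 0 < w -> is_derive z 1 (fun y => heatP y w) (heatG z w).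
Proof.
move=> w0; apply: (is_derive_ceq _ (@heatP_chain id (fun=> w) z 1 0 w0
  (is_derive_fid z) (is_derive_fconst w z))).
by rewrite mulr1 mulr0 addr0.
Qed.

Lemma heatG_continuous w : 0 < w -> continuous (fun z => heatG z w).
Proof. by move=> w0 z; exact: is_derive_continuous (heatG_z z w0). Qed.

Lemma heatGz_continuous w : 0 < w -> continuous (fun z => heatGz z w).
Proof.
move=> w0 z; apply: cvgM; last exact: heatG_continuous.
by apply: cvgN; apply: cvgM; [exact: cvg_id|exact: cvg_cst].
Qed.

Lemma heatG_ge0 z w : 0 <= heatG z w.
Proof. by rewrite divr_ge0 ?sqrtr_ge0// ltW// gauss_gt0. Qed.

Lemma heatG_le z w d : 0 < d -> d <= w -> heatG z w <= (Num.sqrt d)^-1.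
Proof.
move=> d0 dw; rewrite /heatG -[leRHS]mul1r ler_pM ?gauss_le1//.
- exact/ltW/gauss_gt0.
- by rewrite lef_pV2 ?posrE ?sqrtr_gt0// ?(lt_le_trans d0)// ler_wsqrtr.
Qed.

Lemma heatGz_le z w d : 0 < d -> d <= w -> `|heatGz z w| <= d^-1.
Proof.
move=> d0 dw; have w0 : 0 < w by exact: lt_le_trans dw.
have s0 : 0 < Num.sqrt w by rewrite sqrtr_gt0.
have -> : heatGz z w = - (z / Num.sqrt w * gauss (z / Num.sqrt w)) / w.
  by rewrite /heatGz /heatG; field; rewrite !gt_eqF.
rewrite mulNr normrN !normrM -normrM normfV (gtr0_norm w0).
rewrite (gtr0_norm (gauss_gt0 _)) -[leRHS]mul1r.
by rewrite ler_pM ?norm_mul_gauss_le1 ?mulr_ge0 ?invr_ge0 ?(ltW w0)//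
  ?(ltW (gauss_gt0 _))// lef_pV2 ?posrE.
Qed.

Lemma heatP_bounds z w : 0 <= heatP z w <= kap.
Proof. by rewrite Phi_ge0 Phi_le_kap. Qed.

Definition heatP0 z : R := if 0 <= z then kap else 0.
Definition heatE0 z : R := kap * Num.max z 0.

Lemma mul_PhiN_le1 b : b * Phi (- b) <= 1 :> R.
Proof.
have := E1_ge0 (- b); rewrite /E1 => h; have := gauss_le1 (- b : R); lra.
Qed.

Lemma heat_solutionP : heat_solution heatP heatG heatGz heatP0.
Proof.
split.
- exact: heatP_chain.
- exact: heatG_z.
- exact: heatGz_continuous.
- move=> d d0; exists ((Num.sqrt d)^-1 + d^-1).
    by rewrite addr_ge0 ?invr_ge0 ?sqrtr_ge0// ltW.
  move=> z w dw; split.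
    rewrite ger0_norm ?heatG_ge0// (le_trans (heatG_le z d0 dw))// lerDl.
    by rewrite invr_ge0 ltW.
  by rewrite (le_trans (heatGz_le z d0 dw))// lerDr invr_ge0 sqrtr_ge0.
- move=> W; exists kap; first exact/ltW/kap_gt0.
  move=> z w _; have /andP[h0 h1] := heatP_bounds z w.
  rewrite ger0_norm// (le_trans h1)// -[leLHS]mulr1 ler_wpM2l ?weight_ge1//.
  exact/ltW/kap_gt0.
- move=> z w z0 w0; have s0 : 0 < Num.sqrt w by rewrite sqrtr_gt0.
  have n0 : 0 < `|z| by rewrite normr_gt0.
  have : Num.sqrt w / `|z| <= Num.sqrt w * (1 + `|z|^-1).
    by rewrite ler_pM2l// lerDr.
  apply: le_trans; rewrite ler_pdivlMr// /heatP0 /heatP.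
  (* On either side of the jump the error is the Gaussian tail [Phi] at [- (|z| / sqrt w)], by the
     symmetry [PhiN]. The resulting bound degenerates at [z = 0], the point that the record leaves
     out. *)
  have h := mul_PhiN_le1 (`|z| / Num.sqrt w).
  have {h} h : Phi (- (`|z| / Num.sqrt w)) * `|z| <= Num.sqrt w.
    move: h; rewrite mulrAC ler_pdivrMr// mul1r mulrC//.
  case: ifPn => [zge|]; last rewrite -ltNge => zlt.
    rewrite distrC ger0_norm ?subr_ge0 ?Phi_le_kap//.
    by rewrite -PhiN; move: h; rewrite (ger0_norm zge).
  rewrite subr0 ger0_norm ?Phi_ge0//.
  by move: h; rewrite [in Phi _](ltr0_norm zlt) mulNr opprK.
- move=> z z0; apply/cvgrPdist_lt => e e0.
  have z1 : 0 < `|z| by rewrite normr_gt0.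
  near=> y.
  have yz : `|z - y| < `|z|.
    by near: y; have /cvgrPdist_lt := @cvg_id _ (nbhs z); apply.
  have -> : heatP0 y = heatP0 z.
    rewrite /heatP0; congr (if _ then _ else _).
    have [zge|zlt] := leP 0 z.
      by move: yz; rewrite (ger0_norm zge) ltr_norml => /andP[_ ?]; lra.
    by move: yz; rewrite (ltr0_norm zlt) ltr_norml => /andP[? _]; apply/negbTE; rewrite -ltNge; lra.
  by rewrite subrr normr0.
- apply: measurable_fun_ifT => //.
  by apply: measurable_fun_ler.
Unshelve. all: end_near. Qed.

(** Rescaling [E1_near_ramp] gives an initial error of at most [sqrt w] uniformly in [z], from which
    both the growth bound and the initial condition follow. *)
Lemma heat_solutionE : heat_solution heatE heatP heatG heatE0.
Proof.
have cE0 : continuous heatE0.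
  move=> z; apply: cvgM; first exact: cvg_cst.
  by apply: continuous_max; [exact: cvg_id|exact: cvg_cst].
have init z w : 0 < w -> 0 <= heatE z w - heatE0 z <= Num.sqrt w.
  move=> w0; have s0 : 0 < Num.sqrt w by rewrite sqrtr_gt0.
  have /andP[h0 h1] := E1_near_ramp (z / Num.sqrt w).
  have -> : heatE z w - heatE0 z = Num.sqrt w *
      (E1 (z / Num.sqrt w) - kap * Num.max (z / Num.sqrt w) 0).
    rewrite /heatE /heatE0 mulrBr; congr (_ - _).
    rewrite mulrCA; congr (_ * _).
    rewrite maxr_pMr ?(ltW s0)// mulr0 mulrC divfK// gt_eqF//.
  by rewrite mulr_ge0 ?(ltW s0)//= -[leRHS]mulr1 ler_wpM2l// ltW.
split.
- exact: heatE_chain.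
- exact: heatP_z.
- exact: heatG_continuous.
- move=> d d0; exists (kap + (Num.sqrt d)^-1).
    by rewrite addr_ge0 ?invr_ge0 ?sqrtr_ge0// ltW// kap_gt0.
  move=> z w dw; split.
    have /andP[h0 h1] := heatP_bounds z w.
    by rewrite ger0_norm// (le_trans h1)// lerDl invr_ge0 sqrtr_ge0.
  rewrite ger0_norm ?heatG_ge0// (le_trans (heatG_le z d0 dw))// lerDr.
  exact/ltW/kap_gt0.
- move=> W; exists (kap + Num.sqrt W).
    by rewrite addr_ge0 ?sqrtr_ge0// ltW// kap_gt0.
  move=> z w /andP[w0 wW]; have /andP[h0 h1] := init z w w0.
  have hW : Num.sqrt w <= Num.sqrt W by rewrite ler_wsqrtr.
  have hz := normr_ge0 z; have hs := sqrtr_ge0 W; have hk := @kap_gt0 R.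
  have hE0 : `|heatE0 z| <= kap * `|z|.
    rewrite /heatE0 normrM (gtr0_norm hk) ler_wpM2l// ?(ltW hk)//.
    by have [z0|z0] := leP z 0; rewrite ?normr0.
  have -> : heatE z w = heatE0 z + (heatE z w - heatE0 z) by ring.
  rewrite (le_trans (ler_normD _ _))// (ger0_norm h0).
  have := mulr_ge0 hs hz; lra.
- move=> z w z0 w0; have /andP[h0 h1] := init z w w0.
  rewrite ger0_norm// (le_trans h1)// -[leLHS]mulr1 ler_wpM2l ?sqrtr_ge0//.
  by rewrite lerDl invr_ge0.
- by move=> z _; exact: cE0.
- exact: continuous_measurable_fun.
Qed.

End heat_solutions.

(** * Continuity in the weighted space *)

Section weightedL1.
Context {R : realType}.
Local Notation mu := (@lebesgue_measure R).
Implicit Types (f g h : R -> R) (a b k r s t u v x y : R).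
Variable c : R -> R -> R.
Hypothesis c_cont : continuous_weightedL1 c.

Lemma weightedL1_integrable t : 0 <= t -> weighted_integrable (fun x => c x t).
Proof. by have [h _] := c_cont; exact: h. Qed.

Lemma weighted_integrableB f g : weighted_integrable f ->
  weighted_integrable g -> weighted_integrable (fun x => f x - g x).
Proof.
move=> fi gi; rewrite /weighted_integrable.
rewrite (_ : (fun x => _) =
  (fun x => ((1 + `|x|) * f x)%:E - ((1 + `|x|) * g x)%:E)%E).
  exact: integrableB.
by apply/funext => x; rewrite -EFinB mulrBr.
Qed.

Definition weighted_dist t t0 : R :=
  \int[mu]_x ((1 + `|x|) * `|c x t - c x t0|).

Lemma weighted_dist_cvg0 t0 : 0 <= t0 ->
  weighted_dist t t0 @[t --> within `[0, +oo[ (nbhs t0)] --> 0.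
Proof. by move=> t00; have [_ /(_ _ t00) h] := c_cont; exact: fine_cvg. Qed.

Definition weighted_norm t : R := \int[mu]_x ((1 + `|x|) * `|c x t|).

Lemma weighted_norm_dist t t0 : 0 <= t -> 0 <= t0 ->
  `|weighted_norm t - weighted_norm t0| <= weighted_dist t t0.
Proof.
move=> t_ge0 t0_ge0.
have i1 := weighted_integrable_norm (weightedL1_integrable t_ge0).
have i2 := weighted_integrable_norm (weightedL1_integrable t0_ge0).
rewrite /weighted_norm -RintegralB//.
have i3 : mu.-integrable [set: R] (EFin \o
    (fun x => (1 + `|x|) * `|c x t| - (1 + `|x|) * `|c x t0|)).
  rewrite (_ : _ \o _ = (fun x => ((1 + `|x|) * `|c x t|)%:E -
    ((1 + `|x|) * `|c x t0|)%:E)%E); last by apply/funext => x; rewrite -EFinB.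
  exact: integrableB.
rewrite (le_trans (le_normr_Rintegral _ i3))//.
apply: le_Rintegral => //.
- exact: (integrable_abse i3).
- apply: weighted_integrable_norm.
  by apply: weighted_integrableB; exact: weightedL1_integrable.
move=> x _; rewrite -mulrBr normrM ger0_norm; last exact/ltW/weight_gt0.
rewrite ler_wpM2l// ?(ltW (weight_gt0 _))//.
exact: ler_dist_dist.
Qed.

(** The norm is continuous in time by the triangle inequality, hence bounded on a segment; this
    provides the constant [K] that the cutoff estimate needs uniformly in time. *)
Lemma weighted_norm_bounded T :
  exists K : R, forall t, 0 <= t <= T -> weighted_norm t <= K.
Proof.
have cw : {within `[0, T], continuous weighted_norm}.
  apply/subspace_continuousP => t0; rewrite /= in_itv/= => /andP[t00 t0T].
  apply/cvgrPdist_le => e e0.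
  have := weighted_dist_cvg0 t00; move/cvgrPdist_le => /(_ _ e0) he.
  have {}he : \forall t \near nbhs t0, `[0, +oo[%classic t ->
    `|0 - weighted_dist t t0| <= e by exact: he.
  suff : \forall t \near nbhs t0, `[0, T]%classic t ->
    `|weighted_norm t0 - weighted_norm t| <= e by [].
  apply: filterS he => t ht; rewrite /= in_itv/= => /andP[t_ge0 tT].
  move: ht; rewrite /= in_itv/= t_ge0 => /(_ isT); rewrite sub0r normrN => h.
  rewrite distrC (le_trans (weighted_norm_dist t_ge0 t00))//.
  exact: le_trans (ler_norm _) h.
have /compact_bounded[M [_ Mf]] := continuous_compact cw (@segment_compact R 0 T).
exists (M + 1) => t tT; apply: le_trans (ler_norm _) _.
apply: (Mf (M + 1)); first by rewrite ltrDl.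
by exists t => //=; rewrite in_itv.
Qed.

Lemma weighted_integral_dist h k t t0 : 0 <= t -> 0 <= t0 ->
  measurable_fun [set: R] h -> (forall x, `|h x| <= k * (1 + `|x|)) ->
  `|\int[mu]_x (c x t * h x) - \int[mu]_x (c x t0 * h x)|
    <= k * weighted_dist t t0.
Proof.
move=> t_ge0 t0_ge0 mh hk.
have it := weightedL1_integrable t_ge0.
have it0 := weightedL1_integrable t0_ge0.
have ib := weighted_integrableB it it0.
have in_ := weighted_integrable_norm ib.
rewrite -RintegralB//; [|exact: (weighted_integrableM it mh hk)|exact: (weighted_integrableM it0 mh hk)].
under eq_Rintegral do rewrite -mulrBl.
have i3 := weighted_integrableM ib mh hk.
rewrite (le_trans (le_normr_Rintegral _ i3))//.
rewrite /weighted_dist -RintegralZl//.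
apply: le_Rintegral => //.
- exact: (integrable_abse i3).
- rewrite (_ : _ \o _ = (fun x => k%:E * ((1 + `|x|) * `|c x t - c x t0|)%:E)%E).
    exact: integrableZl.
  by apply/funext => x /=; rewrite EFinM.
by move=> x _; rewrite normrM [leLHS]mulrC mulrA ler_wpM2r.
Qed.

Lemma weighted_integral_continuous h k t0 : 0 <= t0 ->
  measurable_fun [set: R] h -> (forall x, `|h x| <= k * (1 + `|x|)) ->
  \int[mu]_x (c x t * h x) @[t --> within `[0, +oo[ (nbhs t0)]
    --> \int[mu]_x (c x t0 * h x).
Proof.
move=> t00 mh hk; apply/cvgrPdist_le => e e0.
have k0 : 0 <= k by have := hk 0; rewrite normr0 addr0 mulr1; exact: le_trans.
have := weighted_dist_cvg0 t00.
have ek : 0 < e / (k + 1) by rewrite divr_gt0//; lra.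
move/cvgrPdist_le => /(_ _ ek) he.
have {}he : \forall t \near nbhs t0, `[0, +oo[%classic t ->
  `|0 - weighted_dist t t0| <= e / (k + 1) by exact: he.
suff : \forall t \near nbhs t0, `[0, +oo[%classic t ->
  `|\int[mu]_x (c x t0 * h x) - \int[mu]_x (c x t * h x)| <= e by [].
apply: filterS he => t ht; rewrite /= in_itv/= andbT => t_ge0.
move: ht; rewrite /= in_itv/= t_ge0 => /(_ isT).
rewrite sub0r normrN => h1; rewrite distrC.
apply: (le_trans (weighted_integral_dist t_ge0 t00 mh hk)).
have h2 : weighted_dist t t0 <= e / (k + 1) := le_trans (ler_norm _) h1.
apply: (le_trans (ler_wpM2l k0 h2)).
rewrite mulrCA -[leRHS]mulr1 ler_wpM2l ?(ltW e0)// ler_pdivrMr; lra.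
Qed.

(** Time and test function move together. Freezing the time at [t0] costs [k] times the weighted
    distance; the test functions then converge by domination against the fixed slice [c x t0].
    Convergence almost everywhere accommodates the jump of the indicator. *)
Lemma weighted_integral_cvg (t_ : nat -> R) t0 (h_ : nat -> R -> R) h k :
  0 <= t0 -> (forall n, 0 <= t_ n) -> t_ n @[n --> \oo] --> t0 ->
  (forall n, measurable_fun [set: R] (h_ n)) -> measurable_fun [set: R] h ->
  (forall n x, `|h_ n x| <= k * (1 + `|x|)) ->
  (\forall x \ae mu, h_ n x @[n --> \oo] --> h x) ->
  \int[mu]_x (c x (t_ n) * h_ n x) @[n --> \oo] --> \int[mu]_x (c x t0 * h x).
Proof.
move=> t00 t_ge0 tt0 mh_ mh hk hh.
have it0 := weightedL1_integrable t00.
have mc := weighted_integrable_measurable it0.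
have h1 : \int[mu]_x (c x t0 * h_ n x) @[n --> \oo] --> \int[mu]_x (c x t0 * h x).
  apply: (@cvg_Rintegral_dominated _ _ _ (fun x => k * ((1 + `|x|) * `|c x t0|))).
  - by move=> n; exact: measurable_funM.
  - exact: measurable_funM.
  - case: hh => N [mN N0 hN]; exists N; split => // x /= hx; apply: hN => /= hf.
    by apply: hx; apply: cvgM => //; exact: cvg_cst.
  - rewrite (_ : _ \o _ = (fun x => k%:E * ((1 + `|x|) * `|c x t0|)%:E)%E).
      exact/integrableZl/weighted_integrable_norm.
    by apply/funext => x /=; rewrite EFinM.
  - by move=> n x; rewrite normrM [leLHS]mulrC mulrA ler_wpM2r.
have h2 : weighted_dist (t_ n) t0 @[n --> \oo] --> 0.
  apply/cvgrPdist_le => e e0.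
  have := weighted_dist_cvg0 t00; move/cvgrPdist_le => /(_ _ e0) he.
  have {}he : \forall t \near nbhs t0, `[0, +oo[%classic t ->
    `|0 - weighted_dist t t0| <= e by exact: he.
  have {}he : \forall n \near \oo, `[0, +oo[%classic (t_ n) ->
    `|0 - weighted_dist (t_ n) t0| <= e by exact: (tt0 _ he).
  apply: filterS he => n; apply.
  by rewrite /= in_itv/= t_ge0.
have h3 : \int[mu]_x (c x (t_ n) * h_ n x) - \int[mu]_x (c x t0 * h_ n x)
    @[n --> \oo] --> 0.
  apply: norm_cvg0.
  apply: (@squeeze_cvgr _ _ _ _ (fun=> 0) (fun n => k * weighted_dist (t_ n) t0)).
  - apply: nearW => n; rewrite normr_ge0/=.
    exact: weighted_integral_dist.
  - exact: cvg_cst.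
  - by rewrite -[X in _ --> X](mulr0 k); apply: cvgM; first exact: cvg_cst.
rewrite (_ : (fun n => _) = (fun n => (\int[mu]_x (c x (t_ n) * h_ n x) -
    \int[mu]_x (c x t0 * h_ n x)) + \int[mu]_x (c x t0 * h_ n x))).
  by rewrite -[X in _ --> X]add0r; exact: (cvgD h3 h1).
by apply/funext => n; rewrite subrK.
Qed.

End weightedL1.

(** * Half-line integrals as integrals against test functions *)

Section half_line.
Context {R : realType}.
Local Notation mu := (@lebesgue_measure R).
Implicit Types (f : R -> R) (k x : R).

Definition half_line_indic x : R := if 0 <= x then 1 else 0.
Definition ramp x : R := Num.max x 0.

Lemma Rintegral_half_line f :
  \int[mu]_(x in `[0, +oo[) f x = \int[mu]_x (f x * half_line_indic x).
Proof.
rewrite Rintegral_mkcond; apply: eq_Rintegral => x _.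
rewrite patchE /half_line_indic mem_setE in_itv/= andbT.
by case: ifPn; rewrite ?mulr1 ?mulr0.
Qed.

Lemma Rintegral_half_line_mul f :
  \int[mu]_(x in `[0, +oo[) (x * f x) = \int[mu]_x (f x * ramp x).
Proof.
rewrite Rintegral_half_line; apply: eq_Rintegral => x _.
rewrite /ramp /half_line_indic; have [x0|x0] := leP x 0.
  case: ifPn => [x0'|_]; last by rewrite !mulr0.
  have -> : x = 0 by apply/eqP; rewrite eq_le x0 x0'.
  by rewrite mulr0 !mul0r.
by rewrite (ltW x0) mulr1 mulrC.
Qed.

Lemma measurable_half_line_indic : measurable_fun [set: R] half_line_indic.
Proof. by apply: measurable_fun_ifT => //; exact: measurable_fun_ler. Qed.

Lemma measurable_ramp : measurable_fun [set: R] ramp.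
Proof.
apply: continuous_measurable_fun => x.
by apply: continuous_max; [exact: cvg_id|exact: cvg_cst].
Qed.

Lemma half_line_indic_le x : `|half_line_indic x| <= 1 * (1 + `|x|).
Proof.
rewrite mul1r /half_line_indic; case: ifPn => _; rewrite ?normr1 ?normr0.
  exact: weight_ge1.
exact/ltW/weight_gt0.
Qed.

Lemma ramp_le x : `|ramp x| <= 1 * (1 + `|x|).
Proof.
have x0 := normr_ge0 x; rewrite mul1r /ramp.
by have [_|_] := leP x 0; rewrite ?normr0; lra.
Qed.

End half_line.

(** * Duality with the backward equation *)

Section duality.
Context {R : realType}.
Local Notation mu := (@lebesgue_measure R).
Implicit Types (f g h : R -> R) (a b k r s t x y z w T : R).
Variables (eps : R) (c : R -> R -> R) (Lam m tau v : R -> R).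
Hypothesis eps_gt0 : 0 < eps.
Hypothesis c_cont : continuous_weightedL1 c.
Hypothesis cC : C21 c.
Hypothesis pde : forall x t, 0 < t ->
  dt c x t = dx (fun y s => (1 - y / Lam s) * c y s) x t
             + eps / 2 * dx (dx c) x t.
Hypothesis Lam_bound : forall T, exists k : R, forall t, 0 <= t <= T ->
  `|(Lam t)^-1| <= k.
Hypothesis m_deriv : forall t, 0 <= t -> is_derive t 1 m (m t / Lam t).
Hypothesis tau_deriv : forall t, 0 <= t -> is_derive t 1 tau (m t)^-1.
Hypothesis v_deriv : forall t, 0 <= t -> is_derive t 1 v (eps / m t ^+ 2).
Hypothesis m_ge1 : forall t, 0 <= t -> 1 <= m t.
Hypothesis m0 : m 0 = 1.
Hypothesis tau0 : tau 0 = 0.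
Hypothesis v0 : v 0 = 0.

Lemma flow_m_gt0 t : 0 <= t -> 0 < m t.
Proof. by move=> /m_ge1; apply: lt_le_trans. Qed.

Lemma flow_tau_le s t : 0 <= s -> s <= t -> tau s <= tau t.
Proof.
move=> s0 st; apply: (@is_derive_ge0_le R tau (fun t => (m t)^-1)) => // x.
  by move=> /andP[sx _]; apply: tau_deriv; exact: le_trans sx.
by move=> /andP[sx _]; rewrite invr_ge0 ltW// flow_m_gt0// (le_trans s0)// ltW.
Qed.

Lemma flow_v_lt s t : 0 <= s -> s < t -> v s < v t.
Proof.
move=> s0 st; apply: (@is_derive_gt0_lt R v (fun t => eps / m t ^+ 2)) => // x.
  by move=> /andP[sx _]; apply: v_deriv; exact: le_trans sx.
move=> /andP[sx _]; rewrite divr_gt0// exprn_gt0// flow_m_gt0//.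
by rewrite (le_trans s0)// ltW.
Qed.

Lemma flow_tau_ge0 t : 0 <= t -> 0 <= tau t.
Proof. by move=> t0; rewrite -tau0 flow_tau_le. Qed.

Lemma flow_v_gt0 t : 0 < t -> 0 < v t.
Proof. by move=> t0; rewrite -v0 flow_v_lt. Qed.

Section backward.
Variables (psi psiz psizz : R -> R -> R) (psi0 : R -> R) (T : R).
Hypothesis hs : heat_solution psi psiz psizz psi0.
Hypothesis T_gt0 : 0 < T.

Let zeta x t : R := x / m t + tau t - tau T.
Let omega t : R := v T - v t.
Let phi x t : R := psi (zeta x t) (omega t).
Let phix x t : R := psiz (zeta x t) (omega t) / m t.
Let phixx x t : R := psizz (zeta x t) (omega t) / m t ^+ 2.

Let omega_gt0 t : 0 <= t -> t < T -> 0 < omega t.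
Proof. by move=> t0 tT; rewrite subr_gt0 flow_v_lt. Qed.

Let zeta_x x t : is_derive x 1 (fun y => zeta y t) (m t)^-1.
Proof.
apply: (is_derive_ceq _ (is_derive_fsub (is_derive_fadd
  (is_derive_fmul (is_derive_fid x) (is_derive_fconst (m t)^-1 x))
  (is_derive_fconst (tau t) x)) (is_derive_fconst (tau T) x))).
ring.
Qed.

(** The time derivative of [zeta] is [(1 - x / Lam t) / m t] and that of [omega] is
    [- eps / m t ^+ 2], so the heat chain rule is exactly the backward equation. *)
Let phi_t x t : 0 <= t -> t < T -> is_derive t 1 (fun s => phi x s)
  ((1 - x / Lam t) * phix x t - eps / 2 * phixx x t).
Proof.
move=> t0 tT; have mt := flow_m_gt0 t0.
have mt0 : m t != 0 by rewrite gt_eqF.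
have hz : is_derive t 1 (fun s => zeta x s)
    (0 * (m t)^-1 + x * (- (m t / Lam t) / m t ^+ 2) + (m t)^-1 - 0).
  exact: is_derive_fsub (is_derive_fadd (is_derive_fmul (is_derive_fconst x t)
    (is_derive_finv mt0 (m_deriv t0))) (tau_deriv t0)) (is_derive_fconst _ t).
have hw : is_derive t 1 omega (0 - eps / m t ^+ 2).
  exact: is_derive_fsub (is_derive_fconst _ t) (v_deriv t0).
apply: (is_derive_ceq _ (heat_chain hs (omega_gt0 t0 tT) hz hw)).
rewrite /phix /phixx; move: (Lam t)^-1 => L.
by field.
Qed.

Let phi_x x t : 0 <= t -> t < T -> is_derive x 1 (fun y => phi y t) (phix x t).
Proof.
move=> t0 tT.
apply: (is_derive_ceq _ (@heat_chain _ _ _ _ _ hs (fun y => zeta y t)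
  (fun=> omega t) x _ _ (omega_gt0 t0 tT) (zeta_x x t) (is_derive_fconst _ x))).
by rewrite mulr0 addr0.
Qed.

Let phi_xx x t : 0 <= t -> t < T -> is_derive x 1 (fun y => phix y t) (phixx x t).
Proof.
move=> t0 tT; have mt0 : m t != 0 by rewrite gt_eqF// flow_m_gt0.
have h : is_derive x 1 (fun y => psiz (zeta y t) (omega t))
    (psizz (zeta x t) (omega t) * (m t)^-1).
  exact: (@is_derive_fcomp R (fun z => psiz z (omega t)) (fun y => zeta y t) x _ _
    (heat_zz hs (zeta x t) (omega_gt0 t0 tT)) (zeta_x x t)).
apply: (is_derive_ceq _ (is_derive_fmul h (is_derive_fconst (m t)^-1 x))).
by rewrite /phixx; field.
Qed.

Let phixx_continuous t : 0 <= t -> t < T -> continuous (fun x => phixx x t).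
Proof.
move=> t0 tT x; apply: cvgM; last exact: cvg_cst.
have h1 := is_derive_continuous (zeta_x x t).
have h2 := @heat_zz_continuous _ _ _ _ _ hs (omega t) (omega_gt0 t0 tT) (zeta x t).
exact: (@continuous_comp _ _ _ (fun y => zeta y t) (fun z => psizz z (omega t)) x h1 h2).
Qed.

Let zeta_bound x t : 0 <= t -> t <= T -> 1 + `|zeta x t| <= (1 + tau T) * (1 + `|x|).
Proof.
move=> t0 tT; have mt := flow_m_gt0 t0.
have tauT := flow_tau_ge0 (ltW T_gt0); have taut := flow_tau_ge0 t0.
have tautT := flow_tau_le t0 tT.
have h1 : `|x / m t| <= `|x|.
  rewrite normrM normfV (gtr0_norm mt) ler_pdivrMr// -[leLHS]mulr1.
  by rewrite ler_wpM2l// m_ge1.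
have h2 : `|tau t - tau T| <= tau T by rewrite ler0_norm; lra.
have h3 : `|zeta x t| <= `|x| + tau T.
  by rewrite /zeta -addrA (le_trans (ler_normD _ _))// lerD.
by have := mulr_ge0 tauT (normr_ge0 x); lra.
Qed.

Let phi_growth : exists2 k : R, 0 <= k & forall x t, 0 <= t -> t < T ->
  `|phi x t| <= k * (1 + `|x|).
Proof.
have [k k0 hk] := heat_growth hs (v T).
have tauT := flow_tau_ge0 (ltW T_gt0).
exists (k * (1 + tau T)); first by rewrite mulr_ge0//; lra.
move=> x t t0 tT; rewrite -mulrA.
apply: le_trans (ler_wpM2l k0 (zeta_bound x t0 (ltW tT))).
apply: hk; rewrite omega_gt0//= /omega gerBl.
by move: t0; rewrite le_eqVlt => /predU1P[<-|/flow_v_gt0/ltW//]; rewrite v0.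
Qed.

(** The times are enclosed in a window [[a, b]] inside [(0, T)]: [a > 0] because the equation holds
    for positive times only, [b < T] because the derivatives of [psi] are bounded only while [omega]
    stays away from 0. *)
Let phi_conserved t1 t2 : 0 < t1 -> t1 < t2 -> t2 < T ->
  \int[mu]_x (c x t1 * phi x t1) = \int[mu]_x (c x t2 * phi x t2).
Proof.
move=> t10 t12 t2T; have T0 := T_gt0.
pose a := t1 / 2; pose b := (t2 + T) / 2.
have a0 : 0 < a by rewrite /a; lra.
have bT : b < T by rewrite /b; lra.
have b0 : 0 <= b by rewrite /b; lra.
have [k1 k10 hk1] := phi_growth.
have [k2 k20 hk2] := heat_bound hs (omega_gt0 b0 bT).
have [k3 hk3] := Lam_bound T.
have [K hK] := weighted_norm_bounded c_cont T.
have k30 : 0 <= k3 by apply: le_trans (normr_ge0 _) (hk3 0 _); rewrite lexx ltW.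
have ab0 t : a <= t <= b -> 0 <= t by move=> /andP[at_ _]; lra.
have abT t : a <= t <= b -> t < T by move=> /andP[_ tb]; lra.
apply: (@weak_conservation R eps c Lam phi phix phixx a b (k1 + k2 + k3) K) => //.
- by rewrite !addr_ge0.
- by move=> x t h; apply: phi_t; [exact: ab0|exact: abT].
- by move=> x t h; apply: phi_x; [exact: ab0|exact: abT].
- by move=> x t h; apply: phi_xx; [exact: ab0|exact: abT].
- by move=> t h; apply: phixx_continuous; [exact: ab0|exact: abT].
- move=> x t h; have t0 := ab0 _ h; have tT := abT _ h.
  have mt1 := m_ge1 t0; have mt := flow_m_gt0 t0.
  have [|z1 z2] := hk2 (zeta x t) (omega t).
    rewrite /omega lerB//; move: h => /andP[_]; rewrite le_eqVlt => /predU1P[->//|].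
    by move=> tb; rewrite ltW// flow_v_lt.
  split.
  + rewrite (le_trans (hk1 x t t0 tT))//.
    by apply: ler_wpM2r; [exact: ltW (weight_gt0 _)|lra].
  + rewrite /phix normrM normfV (gtr0_norm mt) ler_pdivrMr// (le_trans z1)//.
    by rewrite -[leLHS]mulr1; apply: ler_pM => //; lra.
  + rewrite /phixx normrM normfV (gtr0_norm (exprn_gt0 _ mt)).
    rewrite ler_pdivrMr ?exprn_gt0// (le_trans z2)//.
    rewrite -[leLHS]mulr1; apply: ler_pM => //; first lra.
    by rewrite exprn_ege1.
  + rewrite (le_trans (hk3 t _))//; first by rewrite t0 ltW.
    lra.
- by move=> t h; apply: weightedL1_integrable => //; exact: ab0.
- by move=> t h; apply: hK; rewrite ab0// ltW// abT.
- by rewrite /a; lra.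
- by rewrite /b; lra.
Qed.

(** Conservation is pushed to the endpoints. At time 0, [m = 1] and [tau = v = 0] turn [phi] into
    the heat solution at heat time [v T]; at time [T], [omega] vanishes and [psi] returns its
    initial datum at [x / m T]. *)
Lemma duality :
  \int[mu]_x (c x T * psi0 (x / m T)) = \int[mu]_x (c x 0 * psi (x - tau T) (v T)).
Proof.
have T0 := T_gt0.
have e_gt0 n : 0 < n.+3%:R^-1 :> R by rewrite invr_gt0.
have e_lt n : n.+3%:R^-1 <= 3^-1 :> R by rewrite lef_pV2 ?posrE// ler_nat.
have e_cvg : n.+3%:R^-1 @[n --> \oo] --> (0 : R).
  have h := @cvg_harmonic R.
  rewrite -(cvg_shiftn 2) in h; apply: cvg_trans h.
  by apply: near_eq_cvg; apply: nearW => n; rewrite /harmonic/= addn2.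
(* The offset 3 gives [a n <= T / 3], hence [a n < b n] for every [n], including 0. *)
pose a n : R := T * n.+3%:R^-1; pose b n : R := T - T * n.+3%:R^-1.
have T3 n : T * n.+3%:R^-1 <= T * 3^-1 by rewrite ler_pM2l.
have a0 n : 0 < a n by rewrite mulr_gt0.
have bT n : b n < T by rewrite /b ltrBlDr ltrDl mulr_gt0.
have ab n : a n < b n by rewrite /a /b; have := T3 n; move: (T * n.+3%:R^-1) => y; lra.
have b0 n : 0 < b n := lt_trans (a0 n) (ab n).
have aT n : a n < T := lt_trans (ab n) (bT n).
have Te : T * n.+3%:R^-1 @[n --> \oo] --> T * 0 by apply: cvgM => //; exact: cvg_cst.
rewrite mulr0 in Te.
have acvg : a n @[n --> \oo] --> 0 by exact: Te.
have bcvg : b n @[n --> \oo] --> T.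
  by rewrite -[X in _ --> X]subr0; apply: cvgB => //; exact: cvg_cst.
have [k k0 hk] := phi_growth.
have mphi t : 0 <= t -> t < T -> measurable_fun [set: R] (fun x => phi x t).
  move=> t0 tT; apply: continuous_measurable_fun => x.
  exact: is_derive_continuous (phi_x x t0 tT).
have lim0 : \int[mu]_x (c x (a n) * phi x (a n)) @[n --> \oo] -->
    \int[mu]_x (c x 0 * phi x 0).
  apply: (@weighted_integral_cvg R c c_cont a 0 (fun n x => phi x (a n))
    (fun x => phi x 0) k) => //.
  - by move=> n; rewrite ltW.
  - by move=> n; apply: mphi => //; rewrite ltW.
  - exact: mphi.
  - by move=> n x; apply: hk => //; rewrite ltW.
  - apply/aeW => x; have cx := is_derive_continuous (phi_t x (lexx 0) T0).
    exact: (cvg_comp a (fun s => phi x s) acvg cx).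
have limT : \int[mu]_x (c x (b n) * phi x (b n)) @[n --> \oo] -->
    \int[mu]_x (c x T * psi0 (x / m T)).
  have mT := flow_m_gt0 (ltW T0).
  apply: (@weighted_integral_cvg R c c_cont b T (fun n x => phi x (b n))
    (fun x => psi0 (x / m T)) k) => //.
  - by rewrite ltW.
  - by move=> n; rewrite ltW.
  - by move=> n; apply: mphi => //; rewrite ltW.
  - apply: (measurableT_comp (heat_init_measurable hs)).
    by apply: continuous_measurable_fun => x; apply: cvgM; [exact: cvg_id|exact: cvg_cst].
  - by move=> n x; apply: hk => //; rewrite ltW.
  (* Only [x = 0] is lost: it is sent to 0, where [psi0] may jump and the initial estimate is
     void. *)
  - exists [set 0]; split; [by []|exact: lebesgue_measure_set1|].
    move=> x /=; apply: contra_notP => /eqP x0.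
    have zT : x / m T != 0 by rewrite mulf_neq0// invr_neq0// gt_eqF.
    have zcvg : zeta x (b n) @[n --> \oo] --> x / m T.
      have hm := is_derive_continuous (m_deriv (ltW T0)).
      have ht := is_derive_continuous (tau_deriv (ltW T0)).
      rewrite -[X in _ --> X](addrK (tau T)).
      apply: cvgB; last exact: cvg_cst.
      apply: cvgD; last exact: (cvg_comp b tau bcvg ht).
      apply: cvgM; first exact: cvg_cst.
      apply: cvgV; first by rewrite gt_eqF.
      exact: (cvg_comp b m bcvg hm).
    have wcvg : omega (b n) @[n --> \oo] --> (0 : R).
      have hv := is_derive_continuous (v_deriv (ltW T0)).
      rewrite -[X in _ --> X](subrr (v T)).
      by apply: cvgB; [exact: cvg_cst|exact: (cvg_comp b v bcvg hv)].
    have scvg : Num.sqrt (omega (b n)) @[n --> \oo] --> (0 : R).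
      rewrite -[X in _ --> X](@sqrtr0 R).
      exact: (cvg_comp (omega \o b) Num.sqrt wcvg (@sqrt_continuous R 0)).
    have h1 : psi0 (zeta x (b n)) @[n --> \oo] --> psi0 (x / m T).
      exact: (cvg_comp (fun n => zeta x (b n)) psi0 zcvg (heat_init_continuous hs zT)).
    have h2 : Num.sqrt (omega (b n)) * (1 + `|zeta x (b n)|^-1) @[n --> \oo] --> (0 : R).
      rewrite -[X in _ --> X](mul0r (1 + `|x / m T|^-1)).
      apply: cvgM => //; apply: cvgD; first exact: cvg_cst.
      by apply: cvgV; [rewrite normr_eq0|exact: cvg_norm].
    have h3 : phi x (b n) - psi0 (zeta x (b n)) @[n --> \oo] --> (0 : R).
      apply: norm_cvg0.
      apply: (@squeeze_cvgr _ _ _ _ (fun=> 0) _ _ _ _ _ h2); last exact: cvg_cst.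
      have hn0 : \forall n \near \oo, zeta x (b n) != 0.
        exact: (cvgr_neq0 _ zcvg zT).
      apply: filterS hn0 => n hn; rewrite normr_ge0/=.
      apply: (heat_init hs) => //; apply: omega_gt0 => //; exact: ltW.
    rewrite (_ : (fun n => _) = (fun n => (phi x (b n) - psi0 (zeta x (b n))) +
      psi0 (zeta x (b n)))); last by apply/funext => n; rewrite subrK.
    by rewrite -[X in _ --> X]add0r; exact: (cvgD h3 h1).
have e : (fun n => \int[mu]_x (c x (b n) * phi x (b n))) =
    (fun n => \int[mu]_x (c x (a n) * phi x (a n))).
  by apply/funext => n; rewrite (phi_conserved (a0 n) (ab n) (bT n)).
rewrite e in limT.
rewrite (norm_cvg_unique limT lim0); apply: eq_Rintegral => x _.
by rewrite /phi /zeta /omega m0 tau0 v0 divr1 addr0 subr0.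
Qed.

End backward.
End duality.

(** * Moments of the initial datum *)

Section moments.
Context {R : realType}.
Local Notation mu := (@lebesgue_measure R).
Implicit Types (h : R -> R) (a k r s t x y z w : R).

Definition linear_growth h := measurable_fun [set: R] h /\
  exists k : R, forall x, `|h x| <= k * (1 + `|x|).

Lemma linear_growthD h1 h2 : linear_growth h1 -> linear_growth h2 ->
  linear_growth (fun x => h1 x + h2 x).
Proof.
move=> [m1 [k1 b1]] [m2 [k2 b2]]; split; first exact: measurable_funD.
exists (k1 + k2) => x.
by rewrite (le_trans (ler_normD _ _))// mulrDl lerD.
Qed.

Lemma linear_growthZ k h : linear_growth h -> linear_growth (fun x => k * h x).
Proof.
move=> [m1 [k1 b1]]; split; first by apply: measurable_funM.
exists (`|k| * k1) => x.
by rewrite normrM -mulrA ler_wpM2l.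
Qed.

Lemma linear_growth_continuous h k : continuous h ->
  (forall x, `|h x| <= k) -> linear_growth h.
Proof.
move=> ch hk; split; first exact: continuous_measurable_fun.
exists k => x; rewrite (le_trans (hk x))// -[leLHS]mulr1.
rewrite ler_wpM2l ?weight_ge1//; exact: le_trans (hk x).
Qed.

Lemma linear_growth_translate h a : linear_growth h ->
  linear_growth (fun x => h (x - a)).
Proof.
move=> [mh [k hk]]; split.
  apply: (measurableT_comp mh); apply: continuous_measurable_fun => x.
  by apply: cvgB; [exact: cvg_id|exact: cvg_cst].
have k0 : 0 <= k by have := hk 0; rewrite normr0 addr0 mulr1; exact: le_trans.
exists (k * (1 + `|a|)) => x; rewrite (le_trans (hk _))// -mulrA ler_wpM2l//.
have := ler_normB x a; have := mulr_ge0 (normr_ge0 a) (normr_ge0 x); lra.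
Qed.

Lemma linear_growth_heatP a w : 0 < w -> linear_growth (fun x => heatP (x - a) w).
Proof.
move=> w0; apply: (linear_growth_translate (h := fun z => heatP z w)).
apply: (@linear_growth_continuous _ kap) => [z|z].
  exact: is_derive_continuous (heatP_z z w0).
by have /andP[h0 h1] := heatP_bounds z w; rewrite ger0_norm.
Qed.

Lemma linear_growth_heatG a w : 0 < w -> linear_growth (fun x => heatG (x - a) w).
Proof.
move=> w0; apply: (linear_growth_translate (h := fun z => heatG z w)).
apply: (@linear_growth_continuous _ (Num.sqrt w)^-1) => [z|z].
  exact: heatG_continuous.
by rewrite ger0_norm ?heatG_ge0// heatG_le.
Qed.

Lemma linear_growth_heatGz a w : 0 < w -> linear_growth (fun x => heatGz (x - a) w).
Proof.
move=> w0; apply: (linear_growth_translate (h := fun z => heatGz z w)).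
apply: (@linear_growth_continuous _ w^-1) => [z|z].
  exact: heatGz_continuous.
exact: heatGz_le.
Qed.

Lemma linear_growth_heatE a w : 0 < w -> linear_growth (fun x => heatE (x - a) w).
Proof.
move=> w0; apply: (linear_growth_translate (h := fun z => heatE z w)).
have [k k0 hk] := heat_growth heat_solutionE w; split; last first.
  by exists k => z; apply: hk; rewrite w0 lexx.
apply: continuous_measurable_fun => z.
have hz : is_derive z 1 (fun y => heatE y w) (heatP z w * 1 + heatG z w / 2 * 0).
  exact: (@heatE_chain R (fun y => y) (fun=> w) z 1 0 w0
    (is_derive_fid z) (is_derive_fconst w z)).
exact: is_derive_continuous hz.
Qed.

(** The definition of [E1], rescaled. It expresses the kernel through [heatP] and [heatE], so that
    the density is controlled by the mass and the mean. *)
Lemma heatG_identity z w : 0 < w -> w * heatG z w = heatE z w - z * heatP z w.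
Proof.
move=> w0; have s0 : 0 < Num.sqrt w by rewrite sqrtr_gt0.
have sE : w = Num.sqrt w ^+ 2 by rewrite sqr_sqrtr// ltW.
rewrite /heatG /heatE /heatP /E1; move: (Num.sqrt w) sE s0 => s -> s0.
by field; rewrite gt_eqF.
Qed.

(** [mul_E1N_le_Phi] at [b = - z / sqrt w], multiplied by [w]; the next lemma rescales
    [mul_PhiN_le_E1] in the same way. Both carry information when [z = x - a] is negative, that is
    when the datum has been moved far to the left. *)
Lemma heatE_le_heatP z w : 0 < w -> - z * heatE z w <= w * heatP z w.
Proof.
move=> w0; have s0 : 0 < Num.sqrt w by rewrite sqrtr_gt0.
have sE : w = Num.sqrt w ^+ 2 by rewrite sqr_sqrtr// ltW.
have := mul_E1N_le_Phi (- (z / Num.sqrt w)); rewrite opprK.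
rewrite /heatE /heatP; move: (Num.sqrt w) sE s0 => s -> s0.
rewrite -(ler_pM2l (exprn_gt0 2 s0)); apply: le_trans.
by rewrite le_eqVlt; apply/orP; left; apply/eqP; field; rewrite gt_eqF.
Qed.

Lemma heatP_le_heatE z w : 0 < w ->
  - z * w * heatP z w <= (2 * w + z ^+ 2) * heatE z w.
Proof.
move=> w0; have s0 : 0 < Num.sqrt w by rewrite sqrtr_gt0.
have sE : w = Num.sqrt w ^+ 2 by rewrite sqr_sqrtr// ltW.
have := mul_PhiN_le_E1 (- (z / Num.sqrt w)); rewrite opprK.
rewrite /heatE /heatP; move: (Num.sqrt w) sE s0 => s -> s0.
rewrite -(ler_pM2l (exprn_gt0 3 s0)) => h.
apply: (le_trans _ (le_trans h _)); rewrite le_eqVlt; apply/orP; left; apply/eqP.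
  by field; rewrite gt_eqF.
by field; rewrite gt_eqF.
Qed.

Variables (c0 : R -> R) (L : R).
Hypothesis c0_wint : weighted_integrable c0.
Hypothesis c0_ge0 : forall x, 0 <= c0 x.
Hypothesis c0_supp : forall x, c0 x != 0 -> 0 <= x <= L.
Hypothesis c0_pos : 0 < \int[mu]_x c0 x.

Definition moment h : R := \int[mu]_x (c0 x * h x).

Lemma moment_integrable h : linear_growth h ->
  mu.-integrable [set: R] (EFin \o (fun x => c0 x * h x)).
Proof. by move=> [mh [k hk]]; exact: weighted_integrableM hk. Qed.

Lemma moment_le h1 h2 : linear_growth h1 -> linear_growth h2 ->
  (forall x, 0 <= x <= L -> h1 x <= h2 x) -> moment h1 <= moment h2.
Proof.
move=> g1 g2 h12; apply: le_Rintegral => //; [exact: moment_integrable..|].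
move=> x _; have [->|/c0_supp xL] := eqVneq (c0 x) 0; first by rewrite !mul0r.
by rewrite ler_wpM2l// h12.
Qed.

Lemma momentD h1 h2 : linear_growth h1 -> linear_growth h2 ->
  moment (fun x => h1 x + h2 x) = moment h1 + moment h2.
Proof.
move=> g1 g2; rewrite /moment -RintegralD//; [|exact: moment_integrable..].
by apply: eq_Rintegral => x _; rewrite mulrDr.
Qed.

Lemma momentZ k h : linear_growth h -> moment (fun x => k * h x) = k * moment h.
Proof.
move=> g; rewrite /moment -RintegralZl//; last exact: moment_integrable.
by apply: eq_Rintegral => x _; rewrite mulrCA.
Qed.

Lemma moment_cst k : moment (fun=> k) = k * \int[mu]_x c0 x.
Proof.
have g1 : linear_growth (fun=> 1).
  apply: (@linear_growth_continuous _ 1) => x; first exact: cvg_cst.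
  by rewrite normr1.
transitivity (moment (fun x => k * (fun=> 1) x)).
  by congr moment; apply/funext => x; rewrite mulr1.
rewrite momentZ//; congr (_ * _); apply: eq_Rintegral => x _; by rewrite mulr1.
Qed.

Lemma linear_growth_cst k : linear_growth (fun=> k).
Proof. by apply: (@linear_growth_continuous _ `|k|) => x //; exact: cvg_cst. Qed.

Definition heat_mass a w : R := moment (fun x => heatP (x - a) w).
Definition heat_mean a w : R := moment (fun x => heatE (x - a) w).
Definition heat_density a w : R := moment (fun x => heatG (x - a) w).
Definition heat_slope a w : R := moment (fun x => heatGz (x - a) w).

Section inequalities.
Variables (a w : R).
Hypothesis w_gt0 : 0 < w.
Let gP := linear_growth_heatP a w_gt0.
Let gE := linear_growth_heatE a w_gt0.
Let gG := linear_growth_heatG a w_gt0.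
Let gGz := linear_growth_heatGz a w_gt0.

Lemma heatP_ge0 z : 0 <= heatP z w.
Proof. by have /andP[] := heatP_bounds z w. Qed.

Lemma heatE_gt0 z : 0 < heatE z w.
Proof. by rewrite mulr_gt0 ?sqrtr_gt0 ?E1_gt0. Qed.

Lemma heatE_le z1 z2 : z1 <= z2 -> heatE z1 w <= heatE z2 w.
Proof.
by move=> z12; rewrite ler_wpM2l ?sqrtr_ge0// E1_le// ler_wpM2r.
Qed.

Lemma heat_mass_gt0 : 0 < heat_mass a w.
Proof.
apply: (@lt_le_trans _ _ (moment (fun=> heatP (- a) w))).
  by rewrite moment_cst mulr_gt0// Phi_gt0.
apply: moment_le => //; first exact: linear_growth_cst.
move=> x /andP[x0 _]; apply: Phi_le; rewrite ler_wpM2r ?invr_ge0 ?sqrtr_ge0//; lra.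
Qed.

Lemma heat_mean_ge : heatE (- a) w * \int[mu]_x c0 x <= heat_mean a w.
Proof.
rewrite -moment_cst; apply: moment_le => //; first exact: linear_growth_cst.
move=> x /andP[x0 _]; apply: heatE_le; lra.
Qed.

Lemma heat_mean_gt0 : 0 < heat_mean a w.
Proof. by apply: lt_le_trans heat_mean_ge; rewrite mulr_gt0// heatE_gt0. Qed.

Lemma heat_mass_le : heat_mass a w <= kap * \int[mu]_x c0 x.
Proof.
rewrite -moment_cst; apply: moment_le => //; first exact: linear_growth_cst.
by move=> x _; have /andP[] := heatP_bounds (x - a) w.
Qed.

(** On the support [0 <= x <= L], the factor [a - x] in [heatG_identity] lies between [a - L] and
    [a]. The comparisons that follow integrate the pointwise Mills bounds over the support in the
    same manner. *)
Lemma heat_density_ge : (a - L) * heat_mass a w + heat_mean a w <= w * heat_density a w.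
Proof.
rewrite -!momentZ// -momentD//; last exact: linear_growthZ.
apply: moment_le; [by apply: linear_growthD => //; exact: linear_growthZ|exact: linear_growthZ|].
move=> x /andP[x0 xL]; rewrite heatG_identity//.
have : (a - L) * heatP (x - a) w <= (a - x) * heatP (x - a) w.
  by rewrite ler_wpM2r ?heatP_ge0//; lra.
lra.
Qed.

Lemma heat_density_le : w * heat_density a w <= a * heat_mass a w + heat_mean a w.
Proof.
rewrite -!momentZ// -momentD//; last exact: linear_growthZ.
apply: moment_le; [exact: linear_growthZ|by apply: linear_growthD => //; exact: linear_growthZ|].
move=> x /andP[x0 xL]; rewrite heatG_identity//.
have : (a - x) * heatP (x - a) w <= a * heatP (x - a) w.
  by rewrite ler_wpM2r ?heatP_ge0//; lra.
lra.
Qed.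

Lemma heat_mean_le_mass : (a - L) * heat_mean a w <= w * heat_mass a w.
Proof.
rewrite -!momentZ//; apply: moment_le; [exact: linear_growthZ..|].
move=> x /andP[x0 xL]; apply: le_trans (heatE_le_heatP _ w_gt0).
by rewrite ler_wpM2r ?(ltW (heatE_gt0 _))//; lra.
Qed.

Lemma heat_mass_le_mean : L <= a -> (a - L) * w * heat_mass a w <= (2 * w + a ^+ 2) * heat_mean a w.
Proof.
move=> La; rewrite -!momentZ//; apply: moment_le; [exact: linear_growthZ..|].
move=> x /andP[x0 xL].
apply: (@le_trans _ _ (- (x - a) * w * heatP (x - a) w)).
  by rewrite ler_wpM2r ?heatP_ge0// ler_wpM2r ?(ltW w_gt0)//; lra.
apply: le_trans (heatP_le_heatE _ w_gt0) _.
rewrite ler_wpM2r ?(ltW (heatE_gt0 _))// lerD2l -[X in X <= _]sqrrN opprB.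
by rewrite lerXn2r ?nnegrE//; lra.
Qed.

Lemma heat_slope_bounds : L <= a -> 0 <= heat_slope a w <= a / w * heat_density a w.
Proof.
move=> La; apply/andP; split.
  rewrite -[X in X <= _](mul0r (\int[mu]_x c0 x)) -moment_cst.
  apply: moment_le => //; first exact: linear_growth_cst.
  move=> x /andP[x0 xL]; rewrite /heatGz -mulNr opprB.
  by rewrite mulr_ge0 ?heatG_ge0// mulr_ge0 ?invr_ge0 ?(ltW w_gt0)//; lra.
rewrite -momentZ//; apply: moment_le => //; first exact: linear_growthZ.
move=> x /andP[x0 xL]; rewrite /heatGz -mulNr opprB ler_wpM2r ?heatG_ge0//.
by rewrite ler_wpM2r ?invr_ge0 ?(ltW w_gt0)//; lra.
Qed.

End inequalities.

(** The lower bound [v r] on the variance keeps the kernels bounded over the whole window and [B]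
    bounds the speeds, so a multiple of the weighted datum dominates the derivative of the
    integrand. *)
Lemma is_derive_heat_moment (psi psiz psizz : R -> R -> R) (psi0 : R -> R)
    (tau v tau1 v1 : R -> R) t r s B :
  heat_solution psi psiz psizz psi0 ->
  (forall a w, 0 < w -> linear_growth (fun x => psi (x - a) w)) ->
  r < t < s -> 0 < v r -> (forall y, r < y < s -> v r <= v y) ->
  (forall y, r < y < s -> is_derive y 1 tau (tau1 y)) ->
  (forall y, r < y < s -> is_derive y 1 v (v1 y)) ->
  (forall y, r < y < s -> `|tau1 y| <= B /\ `|v1 y| <= B) ->
  is_derive t 1 (fun y => moment (fun x => psi (x - tau y) (v y)))
    (moment (fun x => - tau1 t * psiz (x - tau t) (v t)
                      + v1 t / 2 * psizz (x - tau t) (v t))).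
Proof.
move=> hs gpsi rts vr0 vle dtau dv hB.
have [k k0 hk] := heat_bound hs vr0.
have v0 y : r < y < s -> 0 < v y by move=> /vle; exact: lt_le_trans.
have B0 : 0 <= B by have [h _] := hB t rts; apply: le_trans h.
apply: (@is_derive_Rintegral R (fun y x => c0 x * psi (x - tau y) (v y))
  (fun y x => c0 x * (- tau1 y * psiz (x - tau y) (v y)
                      + v1 y / 2 * psizz (x - tau y) (v y)))
  setT (fun x => B * k * 2 * ((1 + `|x|) * `|c0 x|)) t r s) => //.
- by move=> y rys; apply: moment_integrable; exact: gpsi (v0 _ rys).
- move=> y x rys _.
  have h := heat_chain hs (v0 y rys)
    (is_derive_fsub (is_derive_fconst x y) (dtau y rys)) (dv y rys).
  apply: (is_derive_ceq _ (is_derive_fmul (is_derive_fconst (c0 x) y) h)).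
  by ring.
- by move=> x; rewrite !mulr_ge0// ltW// weight_gt0.
- rewrite (_ : _ \o _ = (fun x => (B * k * 2)%:E * ((1 + `|x|) * `|c0 x|)%:E)%E).
    exact/integrableZl/weighted_integrable_norm.
  by apply/funext => x /=; rewrite EFinM.
move=> y x rys _.
have [h1 h2] := hB y rys; have [h3 h4] := hk (x - tau y) (v y) (vle y rys).
rewrite normrM.
have h5 : `|- tau1 y * psiz (x - tau y) (v y) + v1 y / 2 * psizz (x - tau y) (v y)|
    <= B * k * 2.
  have -> : B * k * 2 = B * k + B * k by ring.
  rewrite (le_trans (ler_normD _ _))// lerD// normrM ?normrN ler_pM//.
  rewrite normrM (ger0_norm (_ : 0 <= 2^-1)) ?invr_ge0//.
  by have := normr_ge0 (v1 y); lra.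
rewrite mulrC ler_pM// -[leLHS]mul1r ler_wpM2r// weight_ge1//.
Qed.

End moments.

(** * Long-time behaviour *)

Section asymptotics.
Context {R : realType}.
Local Notation mu := (@lebesgue_measure R).
Implicit Types (a k r s t x y z w T B : R).

Lemma is_derive_eq_pos (f g : R -> R) t (d : R) : (forall s, 0 < s -> f s = g s) ->
  0 < t -> is_derive t 1 g d -> is_derive t 1 f d.
Proof.
move=> fg t0 gd.
apply: near_eq_is_derive gd.
near=> s; apply/esym/fg; near: s; exact: lt_nbhsr.
Unshelve. all: end_near. Qed.

Lemma cvg0_pinfty (f : R -> R) :
  (forall e : R, 0 < e -> exists t0, forall t, t0 <= t -> `|f t| <= e) ->
  f t @[t --> +oo] --> (0 : R).
Proof.
move=> fe; apply/cvgrPdist_le => e e0; have [t0 ht0] := fe e e0.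
near=> t; rewrite sub0r normrN; apply: ht0.
by near: t; apply: nbhs_pinfty_ge; exact: num_real.
Unshelve. all: end_near. Qed.

Variables (eps : R) (c0 : R -> R) (L : R) (Lam m tau v : R -> R).
Hypothesis eps_gt0 : 0 < eps.
Hypothesis c0_wint : weighted_integrable c0.
Hypothesis c0_ge0 : forall x, 0 <= c0 x.
Hypothesis c0_supp : forall x, c0 x != 0 -> 0 <= x <= L.
Hypothesis c0_pos : 0 < \int[mu]_x c0 x.
Hypothesis m_deriv : forall t, 0 <= t -> is_derive t 1 m (m t / Lam t).
Hypothesis tau_deriv : forall t, 0 <= t -> is_derive t 1 tau (m t)^-1.
Hypothesis v_deriv : forall t, 0 <= t -> is_derive t 1 v (eps / m t ^+ 2).
Hypothesis m_ge1 : forall t, 0 <= t -> 1 <= m t.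
Hypothesis tau0 : tau 0 = 0.
Hypothesis v0 : v 0 = 0.

Let n0 t : R := heat_mass c0 (tau t) (v t).
Let n1 t : R := heat_mean c0 (tau t) (v t).
Let ng t : R := heat_density c0 (tau t) (v t).
Let nz t : R := heat_slope c0 (tau t) (v t).

Hypothesis LamE : forall t, 0 < t -> Lam t = m t * n1 t / n0 t.

Let v_gt0 t : 0 < t -> 0 < v t.
Proof. by move=> t0; exact: (flow_v_gt0 eps_gt0 v_deriv m_ge1 v0). Qed.

Let m_gt0 t : 0 <= t -> 0 < m t.
Proof. exact: flow_m_gt0. Qed.

Let v_le s t : 0 <= s -> s <= t -> v s <= v t.
Proof.
move=> s0; rewrite le_eqVlt => /predU1P[->//|st]; apply: ltW.
exact: (flow_v_lt eps_gt0 v_deriv m_ge1).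
Qed.

Let n0_gt0 t : 0 < t -> 0 < n0 t.
Proof. by move=> t0; apply: (heat_mass_gt0 c0_wint c0_ge0 c0_supp c0_pos); exact: v_gt0. Qed.

Let n1_gt0 t : 0 < t -> 0 < n1 t.
Proof. by move=> t0; apply: (heat_mean_gt0 c0_wint c0_ge0 c0_supp c0_pos); exact: v_gt0. Qed.

Let m_deriv' t : 0 < t -> is_derive t 1 m (n0 t / n1 t).
Proof.
move=> t0; apply: is_derive_ceq (m_deriv (ltW t0)); rewrite LamE//.
by field; rewrite !gt_eqF ?n0_gt0 ?n1_gt0 ?m_gt0// ltW.
Qed.

Let moment_deriv (psi psiz psizz : R -> R -> R) (psi0 : R -> R) t :
  heat_solution psi psiz psizz psi0 ->
  (forall a w, 0 < w -> linear_growth (fun x => psi (x - a) w)) -> 0 < t ->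
  is_derive t 1 (fun y => moment c0 (fun x => psi (x - tau y) (v y)))
    (moment c0 (fun x => - (m t)^-1 * psiz (x - tau t) (v t)
                      + eps / m t ^+ 2 / 2 * psizz (x - tau t) (v t))).
Proof.
move=> hs gpsi t0.
have y0 y : t / 2 < y < t + 1 -> 0 <= y by move=> /andP[h _]; lra.
apply: (@is_derive_heat_moment R c0 c0_wint psi psiz psizz psi0 tau v
  (fun t => (m t)^-1) (fun t => eps / m t ^+ 2) t (t / 2) (t + 1) (1 + eps)) => //.
- by apply/andP; split; lra.
- by apply: v_gt0; lra.
- by move=> y /andP[h _]; apply: v_le; lra.
- by move=> y /y0; exact: tau_deriv.
- by move=> y /y0; exact: v_deriv.
move=> y /y0 h; have my := m_gt0 h; have e0 := eps_gt0; split.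
  rewrite gtr0_norm ?invr_gt0//.
  have : (m y)^-1 <= 1 by rewrite invf_le1// m_ge1.
  lra.
rewrite gtr0_norm ?divr_gt0 ?exprn_gt0// ler_pdivrMr ?exprn_gt0//.
rewrite -[leLHS]mulr1; apply: ler_pM => //; [lra|lra|].
by rewrite exprn_ege1// m_ge1.
Qed.

Let n0_deriv t : 0 < t ->
  is_derive t 1 n0 (- (m t)^-1 * ng t + eps / m t ^+ 2 / 2 * nz t).
Proof.
move=> t0; have w0 := v_gt0 t0.
apply: (is_derive_ceq _ (moment_deriv heat_solutionP linear_growth_heatP t0)).
rewrite momentD//; [|exact/linear_growthZ/linear_growth_heatG|
  exact/linear_growthZ/linear_growth_heatGz].
by rewrite !momentZ//; [exact: linear_growth_heatG|exact: linear_growth_heatGz].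
Qed.

Let n1_deriv t : 0 < t ->
  is_derive t 1 n1 (- (m t)^-1 * n0 t + eps / m t ^+ 2 / 2 * ng t).
Proof.
move=> t0; have w0 := v_gt0 t0.
apply: (is_derive_ceq _ (moment_deriv heat_solutionE linear_growth_heatE t0)).
rewrite momentD//; [|exact/linear_growthZ/linear_growth_heatP|
  exact/linear_growthZ/linear_growth_heatG].
by rewrite !momentZ//; [exact: linear_growth_heatP|exact: linear_growth_heatG].
Qed.

(** The quotient rule for [m * n1 / n0]: the term [m' n1 / n0 = 1] cancels the -1 due to the
    translation in [n1']. The middle term, due to the translation in [n0'], is the one that tends to
    1. *)
Definition dLam t : R := eps / (2 * m t) * (ng t / n0 t)
  + n1 t * ng t / n0 t ^+ 2 - eps / (2 * m t) * (n1 t * nz t / n0 t ^+ 2).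

Lemma is_derive_Lam t : 0 < t -> is_derive t 1 Lam (dLam t).
Proof.
move=> t0; apply: (is_derive_eq_pos LamE t0).
have h0 := n0_gt0 t0; have h1 := n1_gt0 t0; have hm := m_gt0 (ltW t0).
apply: (is_derive_ceq _ (is_derive_fmul
  (is_derive_fmul (m_deriv' t0) (n1_deriv t0))
  (is_derive_finv _ (n0_deriv t0)))); last by rewrite gt_eqF.
by rewrite /dLam; field; rewrite !gt_eqF.
Qed.

Let tau_le s t : 0 <= s -> s <= t -> tau s <= tau t.
Proof. exact: (flow_tau_le tau_deriv m_ge1). Qed.

(** The derivative in the variance is half the kernel, hence nonnegative: smoothing a convex
    function increases it. *)
Let heatE_le_time z w1 w2 : 0 < w1 -> w1 <= w2 -> heatE z w1 <= heatE z w2.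
Proof.
move=> w10 w12; apply: (@is_derive_ge0_le R (fun w => heatE z w)
  (fun w => heatP z w * 0 + heatG z w / 2 * 1)) => // w /andP[hw _].
  exact: (@heatE_chain R (fun=> z) (fun w => w) w 0 1 (lt_le_trans w10 hw)
    (is_derive_fconst z w) (is_derive_fid w)).
by rewrite mulr0 add0r mulr1 divr_ge0// heatG_ge0.
Qed.

Lemma tau_unbounded B : exists2 t0, 0 < t0 & forall t, t0 <= t -> B <= tau t.
Proof.
have [[t0 t00 ht0]|nex] := pselect (exists2 t, 0 < t & B <= tau t).
  by exists t0 => // t tt; apply: le_trans ht0 _; apply: tau_le => //; exact: ltW.
exfalso.
have tauB t : 0 < t -> tau t < B.
  by move=> t0; rewrite ltNge; apply/negP => h; apply: nex; exists t.
have tau_ge0 t : 0 <= t -> 0 <= tau t by move=> t0; rewrite -tau0 tau_le.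
have B0 : 0 < B by apply: le_lt_trans (tauB 1 ltr01); exact: tau_ge0.
have v10 := v_gt0 ltr01.
(* If [tau] stayed below [B], then from time 1 on [n1] would be at least [heatE (- B) (v 1)] times
   the initial mass, while [n0] is at most [kap] times it; hence [k] bounds [m']. *)
pose k := kap / heatE (- B) (v 1).
have hE : 0 < heatE (- B) (v 1) := heatE_gt0 v10 _.
have k0 : 0 < k by rewrite divr_gt0 ?kap_gt0.
have pos y : 1 <= y -> 0 < y by move=> h; lra.
have m_slope y : 1 <= y -> n0 y / n1 y <= k.
  move=> y1; have y0 := pos _ y1; have vy := v_gt0 y0.
  have h1 : heatE (- B) (v 1) * \int[mu]_x c0 x <= n1 y.
    apply: le_trans (heat_mean_ge c0_wint c0_ge0 c0_supp (tau y) vy).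
    rewrite ler_wpM2r ?(ltW c0_pos)//.
    apply: (@le_trans _ _ (heatE (- B) (v y))).
      by apply: heatE_le_time => //; apply: v_le.
    by apply: heatE_le => //; have := tauB y y0; lra.
  have h2 := heat_mass_le c0_wint c0_ge0 c0_supp (tau y) vy.
  rewrite ler_pdivrMr ?n1_gt0//.
  apply: (le_trans h2); apply: le_trans (ler_wpM2l (ltW k0) h1).
  by rewrite /k mulrA divfK// gt_eqF.
have m_le y : 1 <= y -> m y <= m 1 + k * (y - 1).
  move=> y1.
  have := @is_derive_ge0_le R (fun y => k * y - m y) (fun y => 0 * y + k * 1 - n0 y / n1 y) 1 y y1.
  have h : forall x, 1 <= x <= y -> is_derive x 1 (fun y => k * y - m y) (0 * x + k * 1 - n0 x / n1 x).
    move=> x /andP[x1 _]; apply: is_derive_fsub (m_deriv' (pos _ x1)).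
    exact: is_derive_fmul (is_derive_fconst k x) (is_derive_fid x).
  move=> /(_ h) h2.
  have : k * 1 - m 1 <= k * y - m y.
    apply: h2 => x /andP[x1 _]; rewrite mul0r add0r mulr1 subr_ge0.
    by apply: m_slope; exact: ltW.
  lra.
have m1 := m_gt0 ler01.
have lin_gt0 y : 1 <= y -> 0 < m 1 + k * (y - 1).
  by move=> y1; rewrite ltr_wpDr// mulr_ge0 ?(ltW k0)//; lra.
have tau_ge y : 1 <= y -> tau 1 + (ln (m 1 + k * (y - 1)) - ln (m 1)) / k <= tau y.
  move=> y1.
  have h x : 1 <= x <= y -> is_derive x 1
      (fun y => tau y - ln (m 1 + k * (y - 1)) * k^-1)
      ((m x)^-1 - (k / (m 1 + k * (x - 1)) * k^-1)).
    move=> /andP[x1 _]; have x0 : 0 <= x by rewrite ltW// pos.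
    have hl : is_derive x 1 (fun y => m 1 + k * (y - 1)) (0 + (0 * (x - 1) + k * (1 - 0))).
      exact: is_derive_fadd (is_derive_fconst _ x) (is_derive_fmul
        (is_derive_fconst k x) (is_derive_fsub (is_derive_fid x) (is_derive_fconst 1 x))).
    have hln := @is_derive_fln R (fun y => m 1 + k * (y - 1)) x _ (lin_gt0 x x1) hl.
    apply: (is_derive_ceq _ (is_derive_fsub (tau_deriv x0)
      (is_derive_fmul hln (is_derive_fconst k^-1 x)))).
    by rewrite add0r mul0r add0r subr0 mulr1 mulr0 addr0.
  have := is_derive_ge0_le y1 h.
  have h3 x : 1 < x < y -> 0 <= (m x)^-1 - (k / (m 1 + k * (x - 1)) * k^-1).
    move=> /andP[/ltW x1 _].
    have -> : k / (m 1 + k * (x - 1)) * k^-1 = (m 1 + k * (x - 1))^-1.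
      by rewrite mulrC mulrA mulVf ?mul1r// gt_eqF.
    rewrite subr_ge0 lef_pV2 ?posrE ?lin_gt0 ?m_le//.
    by apply: m_gt0; rewrite ltW// pos.
  move=> /(_ h3); rewrite subrr mulr0 addr0.
  have -> : (ln (m 1 + k * (y - 1)) - ln (m 1)) / k =
    ln (m 1 + k * (y - 1)) * k^-1 - ln (m 1) * k^-1 by ring.
  lra.
(* Chosen so that [m 1 + k * (y - 1) = m 1 * expR (k * B)]: the logarithmic lower bound becomes
   [tau 1 + B <= tau y], against [tau y < B]. *)
pose y := 1 + m 1 * (expR (k * B) - 1) / k.
have eB : 1 <= expR (k * B) by rewrite -expR0 ler_expR mulr_ge0 ?(ltW k0)// ltW.
have y1 : 1 <= y by rewrite lerDl divr_ge0 ?(ltW k0)// mulr_ge0 ?(ltW m1)//; lra.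
have := tau_ge y y1.
have -> : m 1 + k * (y - 1) = m 1 * expR (k * B).
  by rewrite /y; field; rewrite gt_eqF.
rewrite lnM ?posrE ?expR_gt0// expRK addrAC subrr add0r mulrAC divff ?gt_eqF// mul1r.
by have := tau_ge0 1 ler01; have := tauB y (pos _ y1); lra.
Qed.

(** Bounds for [n1 * ng / n0 ^+ 2] in the variable [x = 1 / tau]. With [d = tau - L] they are
    [tau / d + V / d ^+ 2] and [d ^+ 2 / (2 * V + tau ^+ 2)]; in this form the limits are read off
    at [x = 0]. *)
Let pup V x : R := (1 - L * x)^-1 + V * (x / (1 - L * x)) ^+ 2.
Let plow V x : R := (1 - L * x) ^+ 2 / (2 * V * x ^+ 2 + 1).

Lemma dLam_squeeze t w1 V : 0 < t -> 1 <= tau t -> L + 1 <= tau t ->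
  0 < w1 -> w1 <= v t -> v t <= V ->
  plow V (tau t)^-1 - eps / 2 * (tau t / m t) / w1 * pup V (tau t)^-1
    <= dLam t <=
  eps / 2 * (tau t / m t) / w1 + eps / 2 * (tau t / m t) + pup V (tau t)^-1.
Proof.
move=> t0 a1 aL w10 w1w wV; have e0 := eps_gt0.
have w0 := v_gt0 t0; have h0 := n0_gt0 t0; have h1 := n1_gt0 t0.
have mu1 := m_ge1 (ltW t0); have mu0 := m_gt0 (ltW t0).
have La : L <= tau t by lra.
have := heat_slope_bounds c0_wint c0_ge0 c0_supp w0 La.
have := heat_mass_le_mean c0_wint c0_ge0 c0_supp w0 La.
have := heat_mean_le_mass c0_wint c0_ge0 c0_supp (tau t) w0.
have := heat_density_le c0_wint c0_ge0 c0_supp (tau t) w0.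
have := heat_density_ge c0_wint c0_ge0 c0_supp (tau t) w0.
rewrite -/(n0 t) -/(n1 t) -/(ng t) -/(nz t) /dLam.
move: (n0 t) (n1 t) (ng t) (nz t) (tau t) (v t) (m t) h0 h1 w0 w1w wV mu1 mu0 a1 aL La.
move=> n0' n1' g z a w mu' h0 h1 w0 w1w wV mu1 mu0 a1 aL La i1 i2 i3 i4 /andP[z0 i5].
(* [X] lies between [d * w / (2 * w + a ^+ 2)] and [w / d], and [Y] between [d / w] and
   [(a + w / d) / w]. The leading powers of [w] cancel in [X * Y], so two-sided bounds on the
   variance suffice. [Y] alone and [X * Z] enter with a factor [1 / m] and are controlled by
   [tau / m]. *)
pose X := n1' / n0'; pose Y := g / n0'; pose Z := z / n0'; pose d := a - L.
have d1 : 1 <= d by rewrite /d; lra.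
have d0 : 0 < d by lra.
have a0 : 0 < a by lra.
have X0 : 0 < X by rewrite divr_gt0.
have Xup : X <= w / d.
  by rewrite ler_pdivlMr// /X mulrAC ler_pdivrMr// mulrC.
have Xlow : d * w / (2 * w + a ^+ 2) <= X.
  rewrite ler_pdivrMr; last by rewrite addr_gt0 ?exprn_gt0 ?mulr_gt0.
  by rewrite /X mulrAC ler_pdivlMr// [leRHS]mulrC.
have Ylow : d / w <= Y.
  rewrite ler_pdivrMr// /Y mulrAC ler_pdivlMr// [leRHS]mulrC.
  by rewrite /d; lra.
have Yup : Y <= (a + w / d) / w.
  rewrite ler_pdivlMr// /Y mulrAC ler_pdivrMr// mulrC (le_trans i2)//.
  have : n1' <= w / d * n0' by rewrite -ler_pdivrMr.
  lra.
have Y0 : 0 <= Y by apply: le_trans Ylow; rewrite divr_ge0 ?ltW.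
have Z0 : 0 <= Z by rewrite divr_ge0// ltW.
have Zup : Z <= a / w * Y.
  by rewrite /Z ler_pdivrMr// /Y mulrA divfK ?gt_eqF.
pose p := X * Y.
have p0 : 0 <= p by rewrite mulr_ge0// ltW.
have aV : 0 < a ^+ 2 by rewrite exprn_gt0.
have dE : 1 - L * a^-1 = d / a by rewrite /d; field; rewrite gt_eqF.
have pupE : pup V a^-1 = a / d + V / d ^+ 2.
  by rewrite /pup dE; field; rewrite !gt_eqF.
have plowE : plow V a^-1 = d ^+ 2 / (2 * V + a ^+ 2).
  have V0 : 0 < 2 * V + a ^+ 2 by rewrite addr_gt0// mulr_gt0//; lra.
  by rewrite /plow dE; field; rewrite !gt_eqF.
have p_up : p <= pup V a^-1.
  apply: (@le_trans _ _ (w / d * ((a + w / d) / w))).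
    by rewrite ler_pM ?(ltW X0).
  have -> : w / d * ((a + w / d) / w) = a / d + w / d ^+ 2.
    by field; rewrite !gt_eqF.
  by rewrite pupE lerD2l ler_wpM2r ?invr_ge0 ?exprn_ge0 ?(ltW d0).
have p_low : plow V a^-1 <= p.
  apply: (@le_trans _ _ (d * w / (2 * w + a ^+ 2) * (d / w))); last first.
    rewrite ler_pM ?divr_ge0 ?(ltW d0) ?(ltW w0)//.
      by rewrite mulr_ge0 ?(ltW d0) ?(ltW w0).
    by rewrite addr_ge0 ?(ltW aV) ?mulr_ge0 ?(ltW w0).
  have W0 : 0 < 2 * w + a ^+ 2 by rewrite addr_gt0 ?mulr_gt0.
  have -> : d * w / (2 * w + a ^+ 2) * (d / w) = d ^+ 2 / (2 * w + a ^+ 2).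
    by field; rewrite !gt_eqF.
  rewrite plowE ler_wpM2l ?exprn_ge0 ?(ltW d0)// lef_pV2 ?posrE//; lra.
pose rho := a / mu'.
have rho0 : 0 < rho by rewrite divr_gt0.
have w1i : w^-1 <= w1^-1 by rewrite lef_pV2 ?posrE.
have term1 : mu'^-1 * Y <= rho / w1 + rho.
  apply: (@le_trans _ _ (mu'^-1 * ((a + w / d) / w))).
    by rewrite ler_wpM2l ?invr_ge0 ?(ltW mu0).
  have -> : mu'^-1 * ((a + w / d) / w) = rho / w + mu'^-1 / d.
    by rewrite /rho; field; rewrite !gt_eqF.
  apply: lerD; first by rewrite ler_wpM2l ?(ltW rho0).
  rewrite /rho mulrC ler_wpM2r ?invr_ge0 ?(ltW mu0)//.
  by rewrite (le_trans _ a1)// invf_le1.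
have term3 : mu'^-1 * (X * Z) <= rho / w1 * pup V a^-1.
  apply: (@le_trans _ _ (rho / w * p)).
    have -> : rho / w * p = mu'^-1 * (X * (a / w * Y)).
      by rewrite /rho /p; field; rewrite !gt_eqF.
    by rewrite ler_wpM2l ?invr_ge0 ?(ltW mu0)// ler_wpM2l ?(ltW X0).
  apply: ler_pM p_up => //; first by rewrite divr_ge0 ?(ltW w0)// ltW.
  by apply: ler_wpM2l w1i; exact: ltW.
have -> : eps / (2 * mu') * (g / n0') + n1' * g / n0' ^+ 2 -
    eps / (2 * mu') * (n1' * z / n0' ^+ 2) =
    eps / 2 * (mu'^-1 * Y) + p - eps / 2 * (mu'^-1 * (X * Z)).
  by rewrite /p /X /Y /Z; field; rewrite !gt_eqF.
have e2 : 0 <= eps / 2 by lra.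
have t1 := ler_wpM2l e2 term1; have t3 := ler_wpM2l e2 term3.
have t1' : 0 <= eps / 2 * (mu'^-1 * Y).
  by rewrite mulr_ge0// mulr_ge0 ?invr_ge0 ?(ltW mu0).
have t3' : 0 <= eps / 2 * (mu'^-1 * (X * Z)).
  by rewrite mulr_ge0// mulr_ge0 ?invr_ge0 ?(ltW mu0)// mulr_ge0 ?(ltW X0).
rewrite -/rho; apply/andP; split.
  have -> : eps / 2 * rho / w1 * pup V a^-1 = eps / 2 * (rho / w1 * pup V a^-1) by ring.
  lra.
have -> : eps / 2 * rho / w1 + eps / 2 * rho = eps / 2 * (rho / w1 + rho) by ring.
lra.
Qed.

Lemma dLam_cvg : dLam t @[t --> +oo] --> (1 : R).
Proof.
have e0 := eps_gt0.
(* From this threshold on, [tau - L >= tau / 2], and both [1 <= tau] and [L + 1 <= tau] hold. *)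
have [T1 T10 hT1] := tau_unbounded (2 * (`|L| + 1)).
have LL := ler_norm L; have nL := normr_ge0 L.
have pos t : T1 <= t -> 0 < t by move=> h; lra.
have posW t : T1 <= t -> 0 <= t by move=> h; lra.
have v_tau t : 0 <= t -> v t <= eps * tau t.
  move=> t0.
  have h x : 0 <= x <= t -> is_derive x 1 (fun y => eps * tau y - v y)
      (0 * tau x + eps * (m x)^-1 - eps / m x ^+ 2).
    move=> /andP[x0 _]; apply: is_derive_fsub (v_deriv x0).
    exact: is_derive_fmul (is_derive_fconst eps x) (tau_deriv x0).
  have := is_derive_ge0_le t0 h; rewrite tau0 v0 mulr0 subr0 => hh.
  rewrite -subr_ge0; apply: hh => x /andP[/ltW x0 _].
  have mx := m_gt0 x0; rewrite mul0r add0r -mulrBr mulr_ge0 ?(ltW e0)// subr_ge0.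
  by rewrite lef_pV2 ?posrE ?exprn_gt0// -[leLHS]expr1 ler_weXn2l// m_ge1.
(* Combining [(tau - L) * n1 <= v * n0] with [v <= eps * tau] and [tau / 2 <= tau - L] gives
   [m' = n0 / n1 >= 1 / (2 * eps)]. *)
pose k := (2 * eps)^-1.
have k0 : 0 < k by rewrite invr_gt0 mulr_gt0.
have slope t : T1 <= t -> k <= n0 t / n1 t.
  move=> tT; have t0 := pos _ tT; have a2 := hT1 t tT.
  have := heat_mean_le_mass c0_wint c0_ge0 c0_supp (tau t) (v_gt0 t0).
  rewrite -/(n0 t) -/(n1 t) => h; have hv := v_tau t (ltW t0).
  have q0 := n0_gt0 t0; have q1 := n1_gt0 t0.
  have a0 : 0 < tau t by lra.
  have h1 : tau t / 2 * n1 t <= tau t * (eps * n0 t).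
    apply: (@le_trans _ _ ((tau t - L) * n1 t)); first by rewrite ler_wpM2r ?(ltW q1)//; lra.
    apply: (le_trans h); rewrite mulrA [tau t * _]mulrC.
    by rewrite ler_wpM2r ?(ltW q0).
  rewrite -mulrA ler_pM2l// in h1.
  rewrite ler_pdivlMr// /k mulrC ler_pdivrMr ?mulr_gt0//; lra.
(* Once [m' >= k], the quantity [v + eps / (k * m)] is nonincreasing, and [V] is its value at
   [T1]. *)
pose V := v T1 + eps / k / m T1.
have mT1 := m_gt0 (ltW T10).
have hV t : T1 <= t -> v t <= V.
  move=> tT.
  have h x : T1 <= x <= t -> is_derive x 1 (fun y => - v y - eps / k * (m y)^-1)
      (- (eps / m x ^+ 2) - (0 * (m x)^-1 + eps / k * (- (n0 x / n1 x) / m x ^+ 2))).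
    move=> /andP[Tx _]; have x0 := pos _ Tx; have mx := m_gt0 (ltW x0).
    apply: is_derive_fsub (is_derive_fopp (v_deriv (ltW x0))) _.
    apply: is_derive_fmul (is_derive_fconst _ x) _.
    by apply: is_derive_finv (m_deriv' x0); rewrite gt_eqF.
  have hh := is_derive_ge0_le tT h.
  have {}hh : - v T1 - eps / k * (m T1)^-1 <= - v t - eps / k * (m t)^-1.
    apply: hh => x /andP[/ltW Tx _]; have x0 := pos _ Tx; have mx := m_gt0 (ltW x0).
    have -> : - (eps / m x ^+ 2) - (0 * (m x)^-1 + eps / k * (- (n0 x / n1 x) / m x ^+ 2)) =
      eps / k / m x ^+ 2 * (n0 x / n1 x - k).
      by field; rewrite !gt_eqF// n1_gt0.
    rewrite mulr_ge0 ?subr_ge0 ?slope// !divr_ge0 ?exprn_ge0 ?(ltW e0) ?(ltW k0) ?(ltW mx)//.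
  have : 0 <= eps / k * (m t)^-1.
    have mt := m_gt0 (posW _ tT).
    by apply: mulr_ge0; [apply: divr_ge0; exact: ltW|rewrite invr_ge0; exact: ltW].
  rewrite /V; lra.
have m_lin t : T1 <= t -> k * (t - T1) <= m t.
  move=> tT.
  have h x : T1 <= x <= t -> is_derive x 1 (fun y => m y - k * y)
      (n0 x / n1 x - (0 * x + k * 1)).
    move=> /andP[Tx _]; apply: is_derive_fsub (m_deriv' (pos _ Tx)) _.
    exact: is_derive_fmul (is_derive_fconst k x) (is_derive_fid x).
  have hh := is_derive_ge0_le tT h.
  have {}hh : m T1 - k * T1 <= m t - k * t.
    apply: hh => x /andP[/ltW Tx _]; rewrite mul0r add0r mulr1 subr_ge0; exact: slope.
  lra.
have tau_ln t : T1 <= t -> tau t <= tau T1 + k^-1 * ln (m t).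
  move=> tT.
  have h x : T1 <= x <= t -> is_derive x 1 (fun y => k^-1 * ln (m y) - tau y)
      (0 * ln (m x) + k^-1 * (n0 x / n1 x / m x) - (m x)^-1).
    move=> /andP[Tx _]; have x0 := pos _ Tx.
    apply: is_derive_fsub (tau_deriv (ltW x0)).
    apply: is_derive_fmul (is_derive_fconst _ x) _.
    exact: is_derive_fln (m_gt0 (ltW x0)) (m_deriv' x0).
  have hh := is_derive_ge0_le tT h.
  have {}hh : k^-1 * ln (m T1) - tau T1 <= k^-1 * ln (m t) - tau t.
    apply: hh => x /andP[/ltW Tx _]; have x0 := pos _ Tx; have mx := m_gt0 (ltW x0).
    have -> : 0 * ln (m x) + k^-1 * (n0 x / n1 x / m x) - (m x)^-1 =
      k^-1 / m x * (n0 x / n1 x - k) by field; rewrite !gt_eqF// n1_gt0.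
    apply: mulr_ge0; last by rewrite subr_ge0 slope.
    by apply: divr_ge0; [rewrite invr_ge0|]; exact: ltW.
  have : 0 <= k^-1 * ln (m T1).
    apply: mulr_ge0; first by rewrite invr_ge0 ltW.
    by rewrite ln_ge0// m_ge1// ltW.
  lra.
(* From [ln m = 2 * ln (sqrt m) <= 2 * sqrt m], the logarithmic bound on [tau] makes [tau / m] of
   order [1 / sqrt m]. *)
pose q t := (Num.sqrt (m t))^-1.
have q_cvg : q t @[t --> +oo] --> (0 : R).
  apply: cvg0_pinfty => e e_gt0; exists (T1 + (k * e ^+ 2)^-1) => t ht.
  have ke : 0 < k * e ^+ 2 by rewrite mulr_gt0 ?exprn_gt0.
  have tT : T1 <= t by apply: le_trans ht; rewrite lerDl invr_ge0 ltW.
  have mt := m_gt0 (posW _ tT).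
  rewrite /q ger0_norm ?invr_ge0 ?sqrtr_ge0//.
  rewrite -[leRHS]invrK lef_pV2 ?posrE ?invr_gt0 ?sqrtr_gt0//.
  rewrite -[leLHS]ger0_norm ?invr_ge0 ?(ltW e_gt0)// -sqrtr_sqr ler_wsqrtr//.
  apply: le_trans (m_lin t tT).
  apply: (@le_trans _ _ (k * (k * e ^+ 2)^-1)); last by rewrite ler_pM2l//; lra.
  by rewrite le_eqVlt; apply/orP; left; apply/eqP; field; rewrite !gt_eqF.
pose rho t := tau t / m t.
have rho_cvg : rho t @[t --> +oo] --> (0 : R).
  apply: (@squeeze_cvgr _ _ _ _ (fun=> 0)
    (fun t => tau T1 * (q t * q t) + 2 * k^-1 * q t)).
  - near=> t; have tT : T1 <= t.
      by near: t; apply: nbhs_pinfty_ge; exact: num_real.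
    have mt := m_gt0 (posW _ tT).
    have s0 : 0 < Num.sqrt (m t) by rewrite sqrtr_gt0.
    have a2 := hT1 t tT.
    rewrite /rho divr_ge0 ?(ltW mt)//=; last lra.
    have mE : m t = Num.sqrt (m t) ^+ 2 by rewrite sqr_sqrtr// ltW.
    have lnm : ln (m t) <= 2 * Num.sqrt (m t).
      rewrite {1}mE lnXn// mulr2n; have := ln_sublinear s0; lra.
    rewrite ler_pdivrMr// (le_trans (tau_ln t tT))//.
    have -> : (tau T1 * (q t * q t) + 2 * k^-1 * q t) * m t =
        tau T1 + k^-1 * (2 * Num.sqrt (m t)).
      rewrite /q; move: (Num.sqrt (m t)) mE s0 => s -> s0.
      by field; rewrite !gt_eqF.
    by rewrite lerD2l ler_wpM2l// invr_ge0 ltW.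
  - exact: cvg_cst.
  rewrite [X in _ --> X](_ : 0 = tau T1 * (0 * 0) + 2 * k^-1 * 0); last by ring.
  apply: cvgD; (apply: cvgM; first exact: cvg_cst) => //.
  exact: cvgM.
have r_cvg : (tau t)^-1 @[t --> +oo] --> (0 : R).
  apply: cvg0_pinfty => e e_gt0.
  have [t0 t00 ht0] := tau_unbounded e^-1; exists t0 => t ht.
  have ei : 0 < e^-1 by rewrite invr_gt0.
  have tt := ht0 t ht; have a0 : 0 < tau t := lt_le_trans ei tt.
  rewrite ger0_norm ?invr_ge0 ?(ltW a0)//.
  by rewrite -[leRHS]invrK lef_pV2 ?posrE.
have lin_cvg : 1 - L * (tau t)^-1 @[t --> +oo] --> 1 - L * 0.
  by apply: cvgB; [exact: cvg_cst|apply: cvgM => //; exact: cvg_cst].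
have one0 : 1 - L * 0 != 0 by rewrite mulr0 subr0 oner_neq0.
have inv_cvg : (1 - L * (tau t)^-1)^-1 @[t --> +oo] --> (1 - L * 0)^-1.
  exact: cvgV.
have pup_cvg : pup V (tau t)^-1 @[t --> +oo] --> (1 : R).
  rewrite [X in _ --> X](_ : 1 = (1 - L * 0)^-1 +
    V * ((0 * (1 - L * 0)^-1) * (0 * (1 - L * 0)^-1))); last first.
    by rewrite mulr0 subr0 invr1 !mul0r mulr0 addr0.
  apply: cvgD => //; apply: cvgM; first exact: cvg_cst.
  by apply: cvgM; exact: cvgM.
have plow_cvg : plow V (tau t)^-1 @[t --> +oo] --> (1 : R).
  rewrite [X in _ --> X](_ : 1 = ((1 - L * 0) * (1 - L * 0)) *
    (2 * V * (0 * 0) + 1)^-1); last first.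
    by rewrite !mulr0 subr0 mulr1 add0r invr1 mulr1.
  apply: cvgM; first exact: cvgM.
  apply: cvgV; first by rewrite !mulr0 add0r oner_neq0.
  apply: cvgD; last exact: cvg_cst.
  by apply: cvgM; [exact: cvg_cst|exact: cvgM].
pose w1 := v T1.
have w10 : 0 < w1 := v_gt0 T10.
have erho_cvg : eps / 2 * rho t @[t --> +oo] --> eps / 2 * 0.
  by apply: cvgM => //; exact: cvg_cst.
have erhow_cvg : eps / 2 * rho t / w1 @[t --> +oo] --> eps / 2 * 0 / w1.
  by apply: cvgM => //; exact: cvg_cst.
apply: (@squeeze_cvgr _ _ _ _
  (fun t => plow V (tau t)^-1 - eps / 2 * rho t / w1 * pup V (tau t)^-1)
  (fun t => eps / 2 * rho t / w1 + eps / 2 * rho t + pup V (tau t)^-1)).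
- near=> t; have tT : T1 <= t.
    by near: t; apply: nbhs_pinfty_ge; exact: num_real.
  have a2 := hT1 t tT.
  have t0 := pos _ tT; have vV := hV t tT.
  have vw : w1 <= v t by apply: v_le => //; exact: ltW.
  by apply: dLam_squeeze => //; lra.
- rewrite [X in _ --> X](_ : 1 = 1 - eps / 2 * 0 / w1 * 1); last by ring.
  by apply: cvgB => //; exact: cvgM.
- rewrite [X in _ --> X](_ : 1 = eps / 2 * 0 / w1 + eps / 2 * 0 + 1); last by ring.
  by apply: cvgD => //; exact: cvgD.
Unshelve. all: end_near. Qed.

End asymptotics.

(** * Conclusion *)

Section Lambda_continuity.
Context {R : realType}.
Local Notation mu := (@lebesgue_measure R).
Implicit Types (k r s t x y : R).
Variable c : R -> R -> R.
Hypothesis c_cont : continuous_weightedL1 c.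
Hypothesis Lam_neq0 : forall t, 0 <= t ->
  \int[mu]_(x in `[0%R, +oo[) c x t != 0 /\ Lambda c t != 0.

Definition half_line_mass t : R := \int[mu]_x (c x t * half_line_indic x).
Definition half_line_mean t : R := \int[mu]_x (c x t * ramp x).

Lemma LambdaE t : Lambda c t = half_line_mean t / half_line_mass t.
Proof. by rewrite /Lambda Rintegral_half_line_mul Rintegral_half_line. Qed.

Lemma half_line_mass_neq0 t : 0 <= t -> half_line_mass t != 0.
Proof. by move=> /Lam_neq0[h _]; rewrite /half_line_mass -(Rintegral_half_line (fun x => c x t)). Qed.

(** Continuity of the solution at time 0 is one-sided. Composition with [clip] extends [Lambda] by
    its value at 0 to negative times, so two-sided continuity holds everywhere and antiderivatives
    can be taken across 0. *)
Definition clip t : R := Num.max t 0.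

Lemma clip_ge0 t : 0 <= clip t. Proof. by rewrite le_max lexx orbT. Qed.

Lemma clip_id t : 0 <= t -> clip t = t.
Proof. by move=> t0; rewrite /clip; apply/max_idPl. Qed.

Lemma continuous_clip : continuous clip.
Proof. by move=> t; apply: continuous_max; [exact: cvg_id|exact: cvg_cst]. Qed.

Lemma cvg_clip (f : R -> R) t :
  f s @[s --> within `[0, +oo[ (nbhs (clip t))] --> f (clip t) ->
  {for t, continuous (fun s => f (clip s))}.
Proof.
move=> cf; apply/cvgrPdist_le => e e0.
move/cvgrPdist_le : cf => /(_ _ e0) he.
have {}he : \forall s \near nbhs (clip t), `[0, +oo[%classic s ->
  `|f (clip t) - f s| <= e by exact: he.
have {}he : \forall s \near nbhs t, `[0, +oo[%classic (clip s) ->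
  `|f (clip t) - f (clip s)| <= e by exact: (@continuous_clip t _ he).
apply: filterS he => s; apply.
by rewrite /= in_itv/= clip_ge0.
Qed.

Lemma continuous_Lambda_clip : continuous (fun t => Lambda c (clip t)).
Proof.
have -> : (fun t => Lambda c (clip t)) =
    (fun t => half_line_mean (clip t) / half_line_mass (clip t)).
  by apply/funext => t; rewrite LambdaE.
move=> t; apply: cvgM.
  apply: (cvg_clip (f := half_line_mean)).
  exact: (weighted_integral_continuous c_cont (clip_ge0 t) measurable_ramp ramp_le).
apply: cvgV; first by rewrite half_line_mass_neq0// clip_ge0.
apply: (cvg_clip (f := half_line_mass)).
exact: (weighted_integral_continuous c_cont (clip_ge0 t) measurable_half_line_indic
  half_line_indic_le).
Qed.

(** The sign comes from the intermediate value theorem, not from a maximum principle: a continuous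
    ratio that never vanishes keeps its initial sign. *)
Lemma Lambda_clip_gt0 : 0 < Lambda c 0 -> forall t, 0 < Lambda c (clip t).
Proof.
move=> L0 t; rewrite ltNge; apply/negP => Lt.
have c0 : clip 0 = 0 by rewrite clip_id.
have [|s _ hs] := @IVT R (fun s => Lambda c (clip s)) 0 (clip t) 0 (clip_ge0 t)
    (continuous_subspaceT continuous_Lambda_clip).
  rewrite c0 (clip_id (clip_ge0 t)) ge_min le_max Lt (ltW L0).
  by rewrite orbT.
by have [_] := Lam_neq0 (clip_ge0 s); rewrite hs eqxx.
Qed.

End Lambda_continuity.

Theorem proposition3p2 (R : realType) (eps : R) (c : R -> R -> R)
  (eps_gt0 : 0 < eps)
  (c0_meas : measurable_fun [set: R] (fun x => c x 0))
  (c0_ge0 : forall x, 0 <= c x 0)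
  (c0_supp : compact (closure [set x | c x 0 != 0]))
  (c0_left : forall x, x < 0 -> c x 0 = 0)
  (c0_int : (0 < \int[@lebesgue_measure R]_(x in `[0%R, +oo[)
                   ((1 + x) * c x 0)%:E < +oo)%E)
  (c_sol : whole_line_solution eps c) :
  (forall t, 0 < t -> derivable (Lambda c) t 1) /\
  (Lambda c)^`()%classic t @[t --> +oo] --> (1 : R).
Proof.
have [c_cont Lam_neq0 cC pde] := c_sol.
have c0_wint : weighted_integrable (fun x => c x 0).
  exact: weightedL1_integrable.
have mass0 : \int[@lebesgue_measure R]_x c x 0 = half_line_mass c 0.
  apply: eq_Rintegral => x _; rewrite /half_line_indic.
  case: ifPn => [_|]; first by rewrite mulr1.
  by rewrite -ltNge => /c0_left ->; rewrite mul0r.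
have c0_pos : 0 < \int[@lebesgue_measure R]_x c x 0.
  rewrite lt_neqAle Rintegral_ge0 ?andbT; last by move=> x _; exact: c0_ge0.
  by rewrite eq_sym mass0; apply: (half_line_mass_neq0 Lam_neq0).
have [L c0_L] : exists L : R, forall x, c x 0 != 0 -> 0 <= x <= L.
  have /compact_bounded[M [_ hM]] := c0_supp.
  exists (M + 1) => x cx; apply/andP; split.
    by rewrite leNgt; apply/negP => /c0_left cx0; rewrite cx0 eqxx in cx.
  apply: le_trans (ler_norm _) _; apply: (hM (M + 1)); first by rewrite ltrDl.
  exact: subset_closure.
have Lam0 : 0 < Lambda c 0.
  have [_ L0] := Lam_neq0 0 (lexx 0).
  rewrite lt_neqAle eq_sym L0/= LambdaE -mass0 divr_ge0 ?(ltW c0_pos)//.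
  apply: Rintegral_ge0 => x _; rewrite mulr_ge0// /ramp le_max lexx orbT//.
pose ell t : R := Lambda c (clip t).
have ell_gt0 (t : R) : 0 < ell t by exact: Lambda_clip_gt0.
have ell_cont : continuous ell by exact: continuous_Lambda_clip.
have ellE (t : R) : 0 <= t -> ell t = Lambda c t by move=> t0; rewrite /ell clip_id.
have ellV_cont : continuous (fun t => (ell t)^-1).
  by move=> t; apply: cvgV; [rewrite gt_eqF|exact: ell_cont].
(* [A] is the integral of [1 / Lambda] from 0, so [m = expR A] solves [m' = m / Lambda] with
   [m 0 = 1], and [A >= 0] gives [m >= 1]. *)
have [A A0 A_deriv] := continuous_antiderivative ellV_cont.
pose m t : R := expR (A t).
have A_ge0 (t : R) : 0 <= t -> 0 <= A t.
  move=> t0; rewrite -A0; apply: (is_derive_ge0_le t0 (df := fun t => (ell t)^-1)).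
    by move=> x /andP[x0 _]; exact: A_deriv.
  by move=> x _; rewrite invr_ge0 ltW.
have m_ge1 (t : R) : 0 <= t -> 1 <= m t.
  by move=> t0; rewrite /m -expR0 ler_expR A_ge0.
have m_gt0 (t : R) : 0 < m t := expR_gt0 _.
have m_deriv (t : R) : 0 <= t -> is_derive t 1 m (m t / Lambda c t).
  by move=> t0; rewrite -ellE//; apply: is_derive_fexpR; exact: A_deriv.
have m_cont : continuous (fun t => m (clip t)).
  move=> t; apply: (@continuous_comp _ _ _ (@clip R) m); first exact: continuous_clip.
  exact: is_derive_continuous (m_deriv _ (clip_ge0 t)).
have [|tau tau0 tau_deriv] := @continuous_antiderivative R (fun t => (m (clip t))^-1).
  by move=> t; apply: cvgV; [rewrite gt_eqF|exact: m_cont].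
have [|v v0 v_deriv] := @continuous_antiderivative R (fun t => eps / m (clip t) ^+ 2).
  move=> t; apply: cvgM; first exact: cvg_cst.
  apply: cvgV; first by rewrite gt_eqF// exprn_gt0.
  exact: (cvgM (@m_cont t) (@m_cont t)).
have {}tau_deriv (t : R) : 0 <= t -> is_derive t 1 tau (m t)^-1.
  by move=> t0; rewrite -[in m t](clip_id t0); exact: tau_deriv.
have {}v_deriv (t : R) : 0 <= t -> is_derive t 1 v (eps / m t ^+ 2).
  by move=> t0; rewrite -[in m t](clip_id t0); exact: v_deriv.
have Lam_bound (T : R) : exists k : R, forall t, 0 <= t <= T -> `|(Lambda c t)^-1| <= k.
  have [k _ hk] := continuous_segment_bounded 0 T ellV_cont.
  by exists k => t /[dup] tT /hk; rewrite ellE//; case/andP: tT.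
have m0 : m 0 = 1 by rewrite /m A0 expR0.
have dual := @duality R eps c (Lambda c) m tau v eps_gt0 c_cont cC pde Lam_bound
  m_deriv tau_deriv v_deriv m_ge1 m0 tau0 v0.
have LamE (t : R) : 0 < t -> Lambda c t =
    m t * heat_mean (fun x => c x 0) (tau t) (v t) / heat_mass (fun x => c x 0) (tau t) (v t).
  move=> t0; have t_ge0 := ltW t0.
  have ct := weightedL1_integrable c_cont t_ge0.
  have k0 := @kap_gt0 R.
  (* Dividing [x] by [m t > 0] keeps its sign, so the indicator is recovered unchanged, whereas the
     positive part is homogeneous and yields the factor [1 / m t] in [meanE]. The common factor
     [kap] cancels in the ratio. *)
  have massE : heat_mass (fun x => c x 0) (tau t) (v t) = kap * half_line_mass c t.
    rewrite /heat_mass /moment -(dual _ _ _ _ _ heat_solutionP t0) /half_line_mass -RintegralZl//.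
      apply: eq_Rintegral => x _; rewrite /heatP0 /half_line_indic.
      rewrite pmulr_lge0 ?invr_gt0//; case: ifPn => _; last by rewrite !mulr0.
      by rewrite mulr1 mulrC.
    exact: (weighted_integrableM ct measurable_half_line_indic half_line_indic_le).
  have meanE : heat_mean (fun x => c x 0) (tau t) (v t) = kap / m t * half_line_mean c t.
    rewrite /heat_mean /moment -(dual _ _ _ _ _ heat_solutionE t0) /half_line_mean -RintegralZl//.
      apply: eq_Rintegral => x _; rewrite /heatE0 /ramp.
      have -> : Num.max (x / m t) 0 = (m t)^-1 * Num.max x 0.
        by rewrite maxr_pMr ?invr_ge0 ?(ltW (m_gt0 t))// mulr0 mulrC.
      by ring.
    exact: (weighted_integrableM ct measurable_ramp ramp_le).
  rewrite LambdaE massE meanE; field.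
  by rewrite (half_line_mass_neq0 Lam_neq0 t_ge0) !gt_eqF.
have dL (t : R) : 0 < t -> is_derive t 1 (Lambda c)
    (dLam eps (fun x => c x 0) m tau v t).
  exact: (is_derive_Lam eps_gt0 c0_wint c0_ge0 c0_L c0_pos m_deriv tau_deriv v_deriv
    m_ge1 v0 LamE).
split=> [t /dL dt|]; first exact: (@ex_derive _ _ _ _ _ _ _ dt).
apply: cvg_trans (dLam_cvg eps_gt0 c0_wint c0_ge0 c0_L c0_pos m_deriv tau_deriv v_deriv
  m_ge1 tau0 v0 LamE).
apply: near_eq_cvg; near=> t; apply/esym.
apply: is_derive_derive1; apply: dL.
by near: t; apply: nbhs_pinfty_gt; exact: num_real.
Unshelve. all: end_near. Qed.
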